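(* Let $\Omega\subset\mathbb{C}^n$ be a bounded domain with boundary $b\Omega$, and suppose $p>2$ ($p<\infty$). Assume that for each point $w\in b\Omega$ there exists a holomorphic function $h:\Omega\to\mathbb{C}$ (a holomorphic peak function) such that (i) $|h(\zeta)|<1$ for every $\zeta\in\Omega$, and (ii) $\lim_{\zeta\to w}|h(\zeta)|=1$ (the limit taken over $\zeta\in\Omega$). Then $\Omega$ is $p$-Skwarczyński complete.
   Context: For a bounded domain $\Omega\subset\mathbb{C}^n$ and $1\le p<\infty$, the $p$-Bergman space is $\mathcal{A}^p(\Omega)=\{f\in L^p(\Omega): f \text{ is holomorphic in }\Omega\}$, with the $L^p(\Omega)$ norm $\|\cdot\|_p$ (Lebesgue measure). For $z\in\Omega$ put $m_p(z)=\inf\{\|f\|_p: f\in\mathcal{A}^p(\Omega),\ f(z)=1\}$. It is known that there is a unique $f\in\mathcal{A}^p(\Omega)$ with $f(z)=1$ attaining this infimum; it is denoted $m_p(\cdot,z)$. The $p$-Skwarczyński distance on $\Omega$ is $$\rho_p(z,w)=\min_{t\in[0,2\pi]}\left\|e^{it}\frac{m_p(\cdot,z)}{m_p(z)}-\frac{m_p(\cdot,w)}{m_p(w)}\right\|_p .$$ It is a distance, since it is known that $m_p(\cdot,z)$ is not a constant multiple of $m_p(\cdot,w)$ when $z\ne w$. $\Omega$ is called $p$-Skwarczyński complete if every $\rho_p$-Cauchy sequence in $\Omega$ converges with respect to $\rho_p$ to a point of $\Omega$. *)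

(* Defs.v *)
From HB Require Import structures.
From mathcomp Require Import all_boot all_order all_algebra.
From mathcomp Require Import all_classical all_reals all_analysis.
From mathcomp Require Import complex.
Set Implicit Arguments.
Unset Strict Implicit.
Unset Printing Implicit Defensive.
Import Order.TTheory GRing.Theory Num.Theory.
Import numFieldNormedType.Exports.
Local Open Scope classical_set_scope.
Local Open Scope ring_scope.

(* The norm topology of R[i] as a field over itself; it makes 'rV[R[i]]_n a
   normed space over R[i], so that [differentiable] below is complex
   (Frechet) differentiability. *)
HB.instance Definition _ (R : realType) := NormedModule.copy R[i] R[i]^o.

Section lebesgue_tuple.
Context (R : realType).
Notation Rm := (measurableTypeR R).

Section step.
Context (n : nat) (mu : {sigma_finite_measure set (n.-tuple Rm) -> \bar R}).

Definition tcons (x : Rm * n.-tuple Rm) : n.+1.-tuple Rm :=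
  [tuple of x.1 :: x.2].

Lemma measurable_tcons : measurable_fun [set: Rm * n.-tuple Rm] tcons.
Proof. by apply: measurable_cons. Qed.

Definition lebesgue_step : set (n.+1.-tuple Rm) -> \bar R :=
  pushforward ((@lebesgue_measure R) \x mu)%E tcons.

HB.instance Definition _ := Measure.copy lebesgue_step
  (measure_function_pushforward__canonical__measure_function_Measure
     ((@lebesgue_measure R) \x mu)%E measurable_tcons).

Let lebesgue_step_sigma_finite :
  sigma_finite [set: n.+1.-tuple Rm] lebesgue_step.
Proof.
have /sigma_finiteP[F [TF ndF Foo]] := sigma_finiteT (@lebesgue_measure R).
have /sigma_finiteP[G [TG ndG Goo]] := sigma_finiteT mu.
exists (fun k => [set y | F k (thead y) /\ G k [tuple of behead y]]).
  apply/seteqP; split => // y _.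
  have [k _ Fk] : (\bigcup_k F k) (thead y) by rewrite -TF.
  have [l _ Gl] : (\bigcup_k G k) [tuple of behead y] by rewrite -TG.
  exists (maxn k l) => //; split.
  - by move: Fk; exact/subsetPset/ndF/leq_maxl.
  - by move: Gl; exact/subsetPset/ndG/leq_maxr.
move=> k; have [mF Fk] := Foo k; have [mG Gk] := Goo k; split.
  apply: (@measurableI _ _ ((@thead _ _) @^-1` F k)
      ((fun y : n.+1.-tuple Rm => [tuple of behead y]) @^-1` G k)).
  - by rewrite -[X in measurable X]setTI; exact: measurable_tnth.
  - by rewrite -[X in measurable X]setTI; exact: measurable_behead.
rewrite /lebesgue_step /pushforward.
rewrite (_ : _ @^-1` _ = F k `*` G k).
  by rewrite product_measure1E// lte_mul_pinfty// ge0_fin_numE.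
apply/seteqP; split => -[x y] /= [Fx Gy]; split => //.
  by rewrite (_ : y = [tuple of behead (tcons (x, y))])//; exact/val_inj.
by rewrite (_ : [tuple of _] = y)//; exact/val_inj.
Qed.

HB.instance Definition _ := Measure_isSigmaFinite.Build _ _ _ lebesgue_step
  lebesgue_step_sigma_finite.

End step.

Fixpoint lebesgue_tuple n : {sigma_finite_measure set (n.-tuple Rm) -> \bar R} :=
  if n is k.+1 then lebesgue_step (lebesgue_tuple k)
  else dirac ([tuple] : 0.-tuple Rm).

Lemma lebesgue_tuple_box n (A : 'I_n -> set Rm) : (forall i, measurable (A i)) ->
  lebesgue_tuple n [set x | forall i, A i (tnth x i)] =
  (\prod_i lebesgue_measure (A i))%E.
Proof.
elim: n A => [A _|n IH A mA].
  by rewrite big_ord0 /= diracE mem_set//= => -[].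
rewrite big_ord_recl /= -IH// /lebesgue_step /pushforward -product_measure1E//.
  congr (_ _); apply/seteqP; split => -[x y] /=.
    move=> h; split; first by have := h ord0.
    by move=> i; have := h (lift ord0 i); rewrite tnthS.
  by move=> [h1 h2] i; case: (unliftP ord0 i) => [j ->|->] //; rewrite tnthS.
rewrite (_ : [set _ | _] =
  \bigcap_(i in [set: 'I_n]) ((@tnth n _ ^~ i) @^-1` A (lift ord0 i))).
  apply: fin_bigcap_measurable => // i _.
  by rewrite -[X in measurable X]setTI; exact: measurable_tnth.
by apply/seteqP; split => x /= h i; [move=> _|]; exact: h.
Qed.

End lebesgue_tuple.

(* C^n is identified with R^(2n) by z_j = x_j + i x_(n+j). *)
Definition complex_point (R : realType) (n : nat)
    (x : (n + n).-tuple (measurableTypeR R)) : 'rV[R[i]]_n :=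
  \row_j (tnth x (lshift n j) +i* tnth x (rshift n j))%C.

Section bergman.
Context (R : realType) (n : nat).
Local Notation Cn := 'rV[R[i]]_n.
Implicit Types (Omega : set Cn) (f : Cn -> R[i]) (z w : Cn).

Definition bounded_domain Omega :=
  [/\ Omega !=set0, open Omega, connected Omega & bounded_set Omega].

Definition boundary Omega : set Cn := closure Omega `\` interior Omega.

Definition holomorphic Omega f := forall z, Omega z -> differentiable f z.

Definition ext_Lp_norm (p : R) Omega f : \bar R :=
  'N[lebesgue_tuple R (n + n)]_p%:E[
    (fun x => (complex.Re `|f (complex_point x)|)%:E)
      \_ (@complex_point R n @^-1` Omega)].

Definition Lp_norm (p : R) Omega f : R := fine (ext_Lp_norm p Omega f).

Definition Lp_fun (p : R) Omega f :=
  [/\ measurable_fun (@complex_point R n @^-1` Omega)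
        (fun x => complex.Re (f (complex_point x))),
      measurable_fun (@complex_point R n @^-1` Omega)
        (fun x => complex.Im (f (complex_point x))) &
      (ext_Lp_norm p Omega f < +oo)%E].

Definition bergman (p : R) Omega : set (Cn -> R[i]) :=
  [set f | Lp_fun p Omega f /\ holomorphic Omega f].

Definition bergman_min (p : R) Omega z : R :=
  inf [set Lp_norm p Omega f | f in [set f | bergman p Omega f /\ f z = 1]].

(* [m_p(., z)]: the minimizer is unique as a function on [Omega]; its values
   outside [Omega] are immaterial, as every norm is taken over [Omega]. *)
Definition bergman_minimizer (p : R) Omega z : Cn -> R[i] :=
  xget (cst 0) [set f | [/\ bergman p Omega f, f z = 1 &
                            Lp_norm p Omega f = bergman_min p Omega z]].

Definition expi (t : R) : R[i] := (cos t +i* sin t)%C.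

(* The minimum over [0, 2pi] is encoded as an infimum; it is attained by
   compactness. *)
Definition skwarczynski_dist (p : R) Omega z w : R :=
  inf [set Lp_norm p Omega (fun zeta =>
         expi t * (bergman_minimizer p Omega z zeta / (bergman_min p Omega z)%:C%C)
         - bergman_minimizer p Omega w zeta / (bergman_min p Omega w)%:C%C)
      | t in [set t : R | 0 <= t <= 2 * pi]].

Definition skwarczynski_cauchy (p : R) Omega (u : nat -> Cn) :=
  forall e : R, 0 < e -> exists N, forall j k, (N <= j)%N -> (N <= k)%N ->
    skwarczynski_dist p Omega (u j) (u k) < e.

Definition skwarczynski_complete (p : R) Omega :=
  forall u : nat -> Cn, (forall k, Omega (u k)) ->
    skwarczynski_cauchy p Omega u ->
    exists2 z, Omega z &
      skwarczynski_dist p Omega (u k) z @[k --> \oo] --> (0 : R).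

End bergman.

(* Main.v *)
(* Write G_z = m_p(., z) / m_p(z), a unit vector of A^p. By the definition of m_p,
   |f(z)| m_p(z) <= ||f|| for every f in A^p, with equality for f = G_z. Along a
   rho_p-Cauchy sequence one extracts a subsequence z_k converging in C^n to some w and
   unimodular constants a_k such that a_k G_{z_k} is Cauchy in A^p; let f be its limit.
   Then ||f|| <= 1, and evaluating f - a_k G_{z_k} at z_k shows that the lower limit of
   |f(z_k)| m_p(z_k) is at least 1. If w were a boundary point with peak function h, then
   |h(z_k)|^j |f(z_k)| m_p(z_k) <= ||h^j f|| would give ||h^j f|| >= 1 for every j, whereas
   h^j f tends to 0 by dominated convergence. So w lies in Omega, where |f(w)| m_p(w) = 1
   follows; as ||f|| <= 1, f / f(w) is the minimizer at w, hence f is a unimodular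
   multiple of G_w and the sequence converges to w.

   Completeness of A^p rests on local bounds of |f| by ||f||, obtained from Cauchy's
   formula on squares applied along complex lines; existence and uniqueness of the
   minimizers rest on Clarkson's inequality for p >= 2. *)
Require Import Defs.
From HB Require Import structures.
From mathcomp Require Import all_boot all_order all_algebra.
From mathcomp Require Import all_classical all_reals all_analysis.
From mathcomp Require Import measurable_realfun complex ring lra.
Set Implicit Arguments.
Unset Strict Implicit.
Unset Printing Implicit Defensive.
Import Order.TTheory GRing.Theory Num.Theory.
Import numFieldNormedType.Exports.
Local Open Scope classical_set_scope.
Local Open Scope ring_scope.

(** * The real-valued modulus *)

(** The distance sees G_z only up to a rotation that depends on the pair of points, so a
    rho_p-Cauchy sequence is not at once a Cauchy sequence of functions. Nearly optimal rotations of
    consecutive terms of a fast subsequence are multiplied up to obtain the constants a_k.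

    Nothing is known about m_p near the boundary. The bound |g(z)| m_p(z) <= ||g|| is therefore used
    at the moving points z_k, and m_p(z_k) is eliminated before any limit is taken. In the boundary
    case the order of limits matters: j stays fixed while k tends to infinity, so that |h(z_k)|^j
    tends to 1, and only then does j grow.

    The function theory is drawn from a single quantitative statement, a second-order Taylor
    estimate whose constants depend only on a bound for |f| on a ball. It bounds differentials,
    shows that uniform limits are holomorphic, and yields the Lipschitz estimate behind the bound on
    point values. *)

Section modulus.
Context {R : realType}.

(* Norms over [R[i]] take values in [R[i]]; [modulus] is the real number behind them. *)
Definition modulus {V : normedZmodType R[i]} (x : V) : R := complex.Re `|x|.

Section normed_zmodule.
Context {V : normedZmodType R[i]}.
Implicit Types x y : V.

Lemma normr_modulus x : `|x| = (modulus x)%:C%C.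
Proof. by rewrite /modulus RRe_real// ger0_real. Qed.

Lemma modulus_ge0 x : 0 <= modulus x.
Proof. by rewrite -ler0c -normr_modulus. Qed.

Lemma modulus0 : modulus (0 : V) = 0.
Proof. by rewrite /modulus normr0. Qed.

Lemma modulus0_eq0 x : modulus x = 0 -> x = 0.
Proof. by move=> x0; apply/normr0_eq0; rewrite normr_modulus x0. Qed.

Lemma modulus_gt0 x : x != 0 -> 0 < modulus x.
Proof.
by move=> x0; rewrite lt_neqAle modulus_ge0 andbT eq_sym; apply: contra_neq x0 => /modulus0_eq0.
Qed.

Lemma modulusN x : modulus (- x) = modulus x.
Proof. by rewrite /modulus normrN. Qed.

Lemma modulusB x y : modulus (x - y) = modulus (y - x).
Proof. by rewrite /modulus distrC. Qed.

Lemma le_modulusD x y : modulus (x + y) <= modulus x + modulus y.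
Proof. by rewrite -lecR rmorphD/= -!normr_modulus ler_normD. Qed.

Lemma ler_dist_modulusD y x z : modulus (x - z) <= modulus (x - y) + modulus (y - z).
Proof. by rewrite (le_trans _ (le_modulusD _ _))// addrA subrK. Qed.

Lemma lerB_modulus x y : modulus x - modulus y <= modulus (x - y).
Proof. by rewrite lerBlDr (le_trans _ (le_modulusD _ _))// subrK. Qed.

End normed_zmodule.

Lemma modulusZ {V : normedModType R[i]} (a : R[i]) (x : V) :
  modulus (a *: x) = modulus a * modulus x.
Proof. by apply: complexI; rewrite rmorphM/= -!normr_modulus normrZ. Qed.

Implicit Types z w : R[i].

Lemma modulusM z w : modulus (z * w) = modulus z * modulus w.
Proof. by apply: complexI; rewrite rmorphM/= -!normr_modulus normrM. Qed.

Lemma modulus1 : modulus (1 : R[i]) = 1.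
Proof. by rewrite /modulus normr1. Qed.

Lemma modulusV z : modulus z^-1 = (modulus z)^-1.
Proof. by apply: complexI; rewrite fmorphV/= -!normr_modulus normfV. Qed.

Lemma modulusX z n : modulus (z ^+ n) = modulus z ^+ n.
Proof. by apply: complexI; rewrite rmorphXn/= -!normr_modulus normrX. Qed.

Lemma modulusR (x : R) : modulus (x%:C%C : R[i]) = `|x|.
Proof. by rewrite /modulus normc_def/= expr0n/= addr0 sqrtr_sqr. Qed.

Lemma sqr_modulus z : modulus z ^+ 2 = complex.Re z ^+ 2 + complex.Im z ^+ 2.
Proof. by rewrite /modulus normc_def/= sqr_sqrtr// addr_ge0 ?sqr_ge0. Qed.

Lemma Re_le_modulus z : `|complex.Re z| <= modulus z.
Proof.
rewrite -(@ler_pXn2r _ 2)// ?nnegrE ?modulus_ge0// sqr_modulus.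
by rewrite real_normK ?num_real// lerDl sqr_ge0.
Qed.

Lemma Im_le_modulus z : `|complex.Im z| <= modulus z.
Proof.
rewrite -(@ler_pXn2r _ 2)// ?nnegrE ?modulus_ge0// sqr_modulus.
by rewrite real_normK ?num_real// lerDr sqr_ge0.
Qed.

Lemma modulus_le_ReIm z : modulus z <= `|complex.Re z| + `|complex.Im z|.
Proof.
rewrite -(@ler_pXn2r _ 2)// ?nnegrE ?modulus_ge0 ?addr_ge0// sqr_modulus.
rewrite sqrrD !real_normK ?num_real// lerD2r lerDl.
by rewrite mulrn_wge0 ?mulr_ge0.
Qed.

End modulus.

(** * Limits and complex differentiability in terms of the real modulus *)

Section topology.
Context {R : realType}.

Lemma nbhs_modulusP {V : normedModType R[i]} (x : V) (A : set V) :
  nbhs x A <-> exists2 e : R, 0 < e & forall y, modulus (y - x) < e -> A y.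
Proof.
split.
- move=> /nbhs_normP[e /= e0 eA].
  have er : e = (complex.Re e)%:C%C by rewrite RRe_real// ger0_real// ltW.
  exists (complex.Re e) => [|y yx]; first by rewrite -ltcR -er.
  by apply: eA; rewrite /ball_/= distrC normr_modulus er ltcR.
- move=> [e e0 eA]; apply/nbhs_normP; exists e%:C%C; first by rewrite /= ltcR.
  by move=> y /=; rewrite distrC normr_modulus ltcR; exact: eA.
Qed.

Lemma cvg_modulusP {T : Type} {F : set_system T} {FF : Filter F}
    {V : normedModType R[i]} (f : T -> V) (l : V) :
  f @ F --> l <-> forall e : R, 0 < e -> \forall x \near F, modulus (f x - l) < e.
Proof.
split => [fl e e0|fl A /nbhs_modulusP[e e0 eA]].
  by apply: (fl [set y | modulus (y - l) < e]); apply/nbhs_modulusP; exists e.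
by near=> x; apply: eA; near: x; exact: fl.
Unshelve. all: by end_near. Qed.

Lemma differentiable_modulusP {V : normedModType R[i]} (f : V -> R[i]) (z : V) :
  differentiable f z -> forall e : R, 0 < e -> exists2 d : R, 0 < d &
    forall h, modulus h < d -> modulus (f (z + h) - f z - 'd f z h) <= e * modulus h.
Proof.
move=> df e e0.
have /diff_locallyP[_ /eqaddoP fe] := df.
have /nbhs_modulusP[d d0 dP] : nbhs (0 : V) (fun h => `|(f \o shift z - (cst (f z) + 'd f z)) h| <= e%:C%C * `|h|).
  by apply: fe; rewrite ltcR.
exists d => // h hd; have := dP h; rewrite subr0 => /(_ hd).
rewrite !normr_modulus -rmorphM/= lecR /= !fctE/=.
by rewrite opprD addrA (addrC h).
Qed.

Lemma modulus_differentiable {V : normedModType R[i]} (f : V -> R[i]) (z : V) (L : {linear V -> R[i]}) :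
  continuous L -> (forall e : R, 0 < e -> exists2 d : R, 0 < d &
    forall h, modulus h < d -> modulus (f (z + h) - f z - L h) <= e * modulus h) ->
  differentiable f z.
Proof.
(* The differential is a chosen linear map satisfying the expansion, so exhibiting [L] as one such
   map suffices. *)
move=> cL fL; apply/diffP/(@getPex _ (fun df : {linear V -> R[i]} =>
  continuous df /\ forall y, f y = f (lim (nbhs z)) + df (y - lim (nbhs z))
                  +o_(y \near z) (y - lim (nbhs z)))).
exists L; split => //; rewrite lim_id//.
suff : f = (fun y => f z + L (y - z)) +o_z (center z) by rewrite funeqE.
apply/eqaddoP => e e0.
have er : e = (complex.Re e)%:C%C by rewrite RRe_real// ger0_real// ltW.
have [|d d0 dP] := fL (complex.Re e); first by rewrite -ltcR -er.
apply/nbhs_modulusP; exists d => // y /dP.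
by rewrite er !normr_modulus -rmorphM/= lecR /= !fctE/= subrKC opprD addrA.
Qed.

End topology.

(** * Contour integrals over rectangles and Cauchy's theorem *)

Section complex_integral.
Context {R : realType}.
Notation mu := (@lebesgue_measure R).
Implicit Types (a b m : R) (f g : R -> R[i]).

Lemma Re_continuous : continuous (@complex.Re R).
Proof.
move=> z; apply: (@cvgrPdist_lt _ _ _ (nbhs z) (nbhs_filter z) _ _).2 => e e0.
apply: (nbhs_modulusP z _).2; exists e => // w wz.
by rewrite distrC -raddfB (le_lt_trans (Re_le_modulus _)).
Qed.

Lemma Im_continuous : continuous (@complex.Im R).
Proof.
move=> z; apply: (@cvgrPdist_lt _ _ _ (nbhs z) (nbhs_filter z) _ _).2 => e e0.
apply: (nbhs_modulusP z _).2; exists e => // w wz.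
by rewrite distrC -raddfB (le_lt_trans (Im_le_modulus _)).
Qed.

Definition continuous_on_segment a b f :=
  forall t, a <= t <= b -> {for t, continuous f}.

Lemma continuous_on_segmentS a b a' b' f : a <= a' -> b' <= b ->
  continuous_on_segment a b f -> continuous_on_segment a' b' f.
Proof.
by move=> aa bb cf t /andP[at_ tb]; apply: cf; rewrite (le_trans aa)//= (le_trans tb).
Qed.

Definition cint a b f : R[i] :=
  ((\int[mu]_(t in `[a, b]) complex.Re (f t)) +i*
   (\int[mu]_(t in `[a, b]) complex.Im (f t)))%C.

Lemma integrable_ReIm a b f : continuous_on_segment a b f ->
  mu.-integrable `[a, b] (EFin \o (@complex.Re R \o f)) /\
  mu.-integrable `[a, b] (EFin \o (@complex.Im R \o f)).
Proof.
move=> cf; split; apply: continuous_compact_integrable; try exact: segment_compact;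
  apply: continuous_in_subspaceT => t; rewrite inE/= in_itv/= => tab.
- by apply: continuous_comp; [exact: cf|exact: Re_continuous].
- by apply: continuous_comp; [exact: cf|exact: Im_continuous].
Qed.

Lemma eq_cint a b f g : (forall t, a <= t <= b -> f t = g t) ->
  cint a b f = cint a b g.
Proof.
move=> fg; congr Complex; apply: eq_Rintegral => t; rewrite inE/= in_itv/= => tab;
  by rewrite fg.
Qed.

Lemma cintD a b f g : continuous_on_segment a b f -> continuous_on_segment a b g ->
  cint a b (fun t => f t + g t) = cint a b f + cint a b g.
Proof.
move=> /integrable_ReIm[f1 f2] /integrable_ReIm[g1 g2].
apply/eqP; rewrite eq_complex/=; apply/andP; split; apply/eqP.
- by rewrite -RintegralD//; apply: eq_Rintegral => t _; rewrite raddfD.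
- by rewrite -RintegralD//; apply: eq_Rintegral => t _; rewrite raddfD.
Qed.

Lemma cintZ a b (k : R[i]) f : continuous_on_segment a b f ->
  cint a b (fun t => k * f t) = k * cint a b f.
Proof.
move=> /integrable_ReIm[f1 f2]; case: k => u v.
have iRe (r : R) : mu.-integrable `[a, b] (fun t => (r * complex.Re (f t))%:E).
  exact: (integrableZl _ r f1).
have iIm (r : R) : mu.-integrable `[a, b] (fun t => (r * complex.Im (f t))%:E).
  exact: (integrableZl _ r f2).
apply/eqP; rewrite eq_complex/=; apply/andP; split; apply/eqP.
- transitivity (\int[mu]_(t in `[a, b]) (u * complex.Re (f t) - v * complex.Im (f t))).
    by apply: eq_Rintegral => t _; case: (f t).
  rewrite (RintegralB _ (iRe u) (iIm v))//.
  by congr (_ - _); exact: RintegralZl.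
- transitivity (\int[mu]_(t in `[a, b]) (u * complex.Im (f t) + v * complex.Re (f t))).
    by apply: eq_Rintegral => t _; case: (f t).
  rewrite (RintegralD _ (iIm u) (iRe v))//.
  by congr (_ + _); exact: RintegralZl.
Qed.

Lemma Rintegral_itv_cst a b (r : R) : a <= b ->
  \int[mu]_(t in `[a, b]) r = r * (b - a).
Proof.
move=> ab; rewrite Rintegral_cst//; congr (_ * _).
apply: (@congr1 _ _ fine _ (b - a)%:E).
apply: (etrans (lebesgue_measure_itv _)).
rewrite /= lte_fin; case: ltP => // ba.
by apply/esym/eqP; rewrite eqe subr_eq0 eq_le ab ba.
Qed.

Lemma cint_cst a b (k : R[i]) : a <= b -> cint a b (fun=> k) = (b - a)%:C%C * k.
Proof.
move=> ab; rewrite /cint !Rintegral_itv_cst//.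
by case: k => u v; simpc; rewrite mulrC (mulrC v).
Qed.

Lemma cintB a b f g : continuous_on_segment a b f -> continuous_on_segment a b g ->
  cint a b (fun t => f t - g t) = cint a b f - cint a b g.
Proof.
move=> cf cg.
have cNg : continuous_on_segment a b (fun t => -1 * g t).
  by move=> t tab; apply: cvgM; [exact: cvg_cst|exact: cg].
rewrite -[X in _ + X]mulN1r -cintZ// -cintD//.
by apply: eq_cint => t _; rewrite mulN1r.
Qed.

Lemma cint_split a m b f : a <= m -> m <= b -> continuous_on_segment a b f ->
  cint a b f = cint a m f + cint m b f.
Proof.
move=> am mb /integrable_ReIm[f1 f2].
have split_int h : mu.-integrable `[a, b] (EFin \o h) ->
    \int[mu]_(t in `[a, b]) h t =
    \int[mu]_(t in `[a, m]) h t + \int[mu]_(t in `[m, b]) h t.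
  move=> ih; apply/eqP; rewrite addrC -subr_eq; apply/eqP.
  rewrite Rintegral_itvB ?bnd_simp//.
  apply: Rintegral_itv_obnd_cbnd; apply: integrableS ih => //.
  by apply: subset_itvr; rewrite bnd_simp.
by apply/eqP; rewrite eq_complex/= -!split_int ?eqxx.
Qed.

(* The factor 2 comes from bounding the real and imaginary parts separately. *)
Lemma modulus_cint_le a b f (M : R) : a <= b -> continuous_on_segment a b f ->
  (forall t, a <= t <= b -> modulus (f t) <= M) ->
  modulus (cint a b f) <= 2 * M * (b - a).
Proof.
move=> ab /integrable_ReIm[f1 f2] fM.
have bound h : mu.-integrable `[a, b] (EFin \o h) ->
    (forall t, a <= t <= b -> `|h t| <= M) ->
    `|\int[mu]_(t in `[a, b]) h t| <= M * (b - a).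
  move=> ih hM; rewrite (le_trans (le_normr_Rintegral _ _))//.
  have -> : M * (b - a) = \int[mu]_(t in `[a, b]) M.
    by rewrite Rintegral_itv_cst.
  apply: le_Rintegral => //.
  - exact: (integrable_norm ih).
  - apply: continuous_compact_integrable; first exact: segment_compact.
    by apply: continuous_subspaceT => t; exact: cvg_cst.
rewrite (le_trans (modulus_le_ReIm _))// mulrAC -mulrA mulr2n mulrDl mul1r.
rewrite (mulrC (b - a)) lerD ?bound// => t /fM; apply: le_trans.
- exact: Re_le_modulus.
- exact: Im_le_modulus.
Qed.

End complex_integral.

(** * Induction on subdivisions of a rectangle *)

Section rectangle_bisection.
Context {R : realType}.

(** If [P] failed on the whole rectangle, every bad rectangle would have a bad quarter. The
    resulting nested bad rectangles shrink to a point, where the local hypothesis contradicts their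
    badness. *)
Lemma rectangle_bisection (P : R -> R -> R -> R -> Prop) (a b c d : R) :
  a <= b -> c <= d ->
  (forall a' b' c' d', a <= a' -> a' <= b' -> b' <= b ->
     c <= c' -> c' <= d' -> d' <= d ->
     let m := (a' + b') / 2 in let l := (c' + d') / 2 in
     P a' m c' l -> P m b' c' l -> P a' m l d' -> P m b' l d' -> P a' b' c' d') ->
  (forall x y, a <= x <= b -> c <= y <= d -> exists2 e, 0 < e &
     forall a' b' c' d', a <= a' -> b' <= b -> c <= c' -> d' <= d ->
     a' <= x <= b' -> c' <= y <= d' -> (b' - a') + (d' - c') < e ->
     P a' b' c' d') ->
  P a b c d.
Proof.
move=> ab cd quarter loc; apply: contrapT => nP.
pose X := {q : (R * R) * (R * R) | [/\ a <= q.1.1, q.1.1 <= q.1.2 & q.1.2 <= b] /\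
  [/\ c <= q.2.1, q.2.1 <= q.2.2 & q.2.2 <= d] /\ ~ P q.1.1 q.1.2 q.2.1 q.2.2}.
pose half (q q' : R * R) := [/\ q.1 <= q'.1, q'.2 <= q.2 & q'.2 - q'.1 = (q.2 - q.1) / 2].
pose next (q q' : X) := half (sval q).1 (sval q').1 /\ half (sval q).2 (sval q').2.
have nextP (q : X) : {q' : X | next q q'}.
  apply: cid; case: q => -[[a' b'] [c' d']]/= [[/= aa' ab' bb'] [[/= cc' cd' dd'] nPq]].
  pose m := (a' + b') / 2; pose l := (c' + d') / 2.
  have am : a' <= m by rewrite /m; lra.
  have mb : m <= b' by rewrite /m; lra.
  have cl : c' <= l by rewrite /l; lra.
  have ld : l <= d' by rewrite /l; lra.
  have build a1 b1 c1 d1 : ~ P a1 b1 c1 d1 -> half (a', b') (a1, b1) ->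
      half (c', d') (c1, d1) -> exists q' : X,
      half (a', b') (sval q').1 /\ half (c', d') (sval q').2.
    move=> nP1 h1 h2; suff q'P : [/\ a <= a1, a1 <= b1 & b1 <= b] /\
        [/\ c <= c1, c1 <= d1 & d1 <= d] /\ ~ P a1 b1 c1 d1.
      by exists (exist _ ((a1, b1), (c1, d1)) q'P).
    case: h1 h2 => /= h1 h2 h3 [/= h4 h5 h6].
    by split; [split; lra|split; [split; lra|]].
  have hl : half (a', b') (a', m) by split => //=; rewrite /m; lra.
  have hr : half (a', b') (m, b') by split => //=; rewrite /m; lra.
  have hb : half (c', d') (c', l) by split => //=; rewrite /l; lra.
  have ht : half (c', d') (l, d') by split => //=; rewrite /l; lra.
  have [P1|] := pselect (P a' m c' l); last by move/build; exact.
  have [P2|] := pselect (P m b' c' l); last by move/build; exact.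
  have [P3|] := pselect (P a' m l d'); last by move/build; exact.
  have [P4|] := pselect (P m b' l d'); last by move/build; exact.
  by exfalso; exact/nPq/(quarter _ _ _ _ aa' ab' bb' cc' cd' dd').
have q0P : [/\ a <= a, a <= b & b <= b] /\ [/\ c <= c, c <= d & d <= d] /\ ~ P a b c d.
  by do !split.
have [q [q0 qS]] := dependent_choice nextP (exist _ ((a, b), (c, d)) q0P).
pose u k := (sval (q k)).1; pose v k := (sval (q k)).2.
(* Applied to each coordinate separately: the supremum of the left ends lies in all the
   intervals. *)
have nested (w : nat -> R * R) : (forall k, half (w k) (w k.+1)) ->
    (forall k, (w k).1 <= (w k).2) ->
    (exists x, forall k, (w k).1 <= x <= (w k).2) /\
    (forall k, (w k).2 - (w k).1 = ((w 0%N).2 - (w 0%N).1) / 2 ^+ k).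
  move=> wS w12; split.
    have w1 : {homo (fun k => (w k).1) : n m / (n <= m)%N >-> n <= m}.
      by apply/nondecreasing_seqP => k; have [] := wS k.
    have w2 : {homo (fun k => (w k).2) : n m / (n <= m)%N >-> n >= m}.
      by apply/nonincreasing_seqP => k; have [] := wS k.
    have ub k : ubound (range (fun k => (w k).1)) (w k).2.
      move=> _ [j _ <-]; have [jk|/ltnW kj] := leqP j k.
        by rewrite (le_trans (w1 _ _ jk)).
      by rewrite (le_trans (w12 _))// w2.
    exists (sup (range (fun k => (w k).1))) => k; apply/andP; split.
      by apply: ub_le_sup; [exists (w 0%N).2; exact: ub|exists k].
    by apply: ge_sup; [exists (w 0%N).1, 0%N|exact: ub].
  elim=> [|k IH]; first by rewrite expr0 divr1.
  by have [_ _ ->] := wS k; rewrite IH exprSr invfM mulrA.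
have [k|k|[x xP] ux] := nested u; first by have [] := qS k.
  by rewrite /u; case: (q k) => ? [[]].
have [k|k|[y yP] vy] := nested v; first by have [] := qS k.
  by rewrite /v; case: (q k) => ? [? [[]]].
have u0 : u 0%N = (a, b) by rewrite /u q0.
have v0 : v 0%N = (c, d) by rewrite /v q0.
have [||e e0 eP] := loc x y; first by have := xP 0%N; rewrite u0.
  by have := yP 0%N; rewrite v0.
have [k ke] : exists k, ((b - a) + (d - c)) / 2 ^+ k < e.
  have h2 : `|2^-1 : R| < 1 by rewrite ger0_norm ?invr_ge0//; lra.
  have /cvgrPdist_lt/(_ _ e0)[k _ /(_ k)] :=
    @cvg_geometric R ((b - a) + (d - c)) 2^-1 h2.
  rewrite /= leqnn sub0r normrN => /(_ isT) ke; exists k.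
  by rewrite -exprVn (le_lt_trans (ler_norm _) ke).
have := erefl (sval (q k)); case: {2}(q k) => -[[a' b'] [c' d']].
move=> /= [[/= aa' ab' bb'] [[/= cc' cd' dd'] nPq]] qk.
apply: nPq; apply: eP => //.
- by have := xP k; rewrite /u qk.
- by have := yP k; rewrite /v qk.
- have := ux k; have := vy k; rewrite /u /v qk/= -/(u 0%N) -/(v 0%N) u0 v0/= => -> ->.
  by rewrite -mulrDl.
Qed.

End rectangle_bisection.

(** * Integrals along the border of a rectangle *)

Section contour_integral.
Context {R : realType}.
Implicit Types (a b c d : R) (f g : R[i] -> R[i]) (z : R[i]).

Definition rectangle a b c d z :=
  (a <= complex.Re z <= b) && (c <= complex.Im z <= d).

Definition rectangle_border a b c d z := rectangle a b c d z &&
  [|| complex.Re z == a, complex.Re z == b, complex.Im z == c | complex.Im z == d].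

Lemma horizontal_border a b c d t : c <= d -> a <= t <= b ->
  rectangle_border a b c d (t +i* c)%C /\ rectangle_border a b c d (t +i* d)%C.
Proof.
by move=> cd tab; rewrite /rectangle_border /rectangle/= tab !lexx cd !eqxx !orbT.
Qed.

Lemma vertical_border a b c d t : a <= b -> c <= t <= d ->
  rectangle_border a b c d (b +i* t)%C /\ rectangle_border a b c d (a +i* t)%C.
Proof.
by move=> ab tcd; rewrite /rectangle_border /rectangle/= tcd !lexx ab !eqxx !orbT.
Qed.

(** The border is run through counterclockwise: dz is dx on the horizontal sides and i dy on the
    vertical ones. *)
Definition contour a b c d f : R[i] :=
  cint a b (fun x => f (x +i* c)%C) - cint a b (fun x => f (x +i* d)%C) +
  'i%C * (cint c d (fun y => f (b +i* y)%C) - cint c d (fun y => f (a +i* y)%C)).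

Lemma horizontal_sub x t c : ((t +i* c)%C - (x +i* c)%C = (t - x)%:C%C :> R[i]).
Proof. exact: (congr2 (@Complex R) (erefl (t - x)) (subrr c)). Qed.

Lemma vertical_sub y t c : ((c +i* t)%C - (c +i* y)%C = 'i%C * (t - y)%:C%C :> R[i]).
Proof.
by apply/eqP; rewrite eq_complex; apply/andP; split; apply/eqP => /=; ring.
Qed.

Lemma modulus_i : modulus ('i%C : R[i]) = 1.
Proof.
by apply/eqP; rewrite -sqrp_eq1 ?modulus_ge0// sqr_modulus/= expr0n/= add0r expr1n.
Qed.

Lemma horizontal_continuous c : continuous (fun x : R => (x +i* c)%C).
Proof.
move=> x; apply/cvg_modulusP => e e0; near=> t.
by rewrite horizontal_sub modulusR distrC; near: t; apply: cvgr_dist_lt.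
Unshelve. all: by end_near. Qed.

Lemma vertical_continuous a : continuous (fun y : R => (a +i* y)%C).
Proof.
move=> y; apply/cvg_modulusP => e e0; near=> t.
by rewrite vertical_sub modulusM modulusR distrC modulus_i mul1r; near: t; apply: cvgr_dist_lt.
Unshelve. all: by end_near. Qed.

Lemma horizontal_segment a b c f :
  (forall x, a <= x <= b -> {for (x +i* c)%C, continuous f}) ->
  continuous_on_segment a b (fun x => f (x +i* c)%C).
Proof.
move=> cf x xab; apply: (@continuous_comp _ _ _ (fun x : R => (x +i* c)%C) f).
  exact: horizontal_continuous.
exact: cf.
Qed.

Lemma vertical_segment a c d f :
  (forall y, c <= y <= d -> {for (a +i* y)%C, continuous f}) ->
  continuous_on_segment c d (fun y => f (a +i* y)%C).
Proof.
move=> cf x xab; apply: (@continuous_comp _ _ _ (fun y : R => (a +i* y)%C) f).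
  exact: vertical_continuous.
exact: cf.
Qed.

Definition continuous_on_border a b c d f :=
  forall z, rectangle_border a b c d z -> {for z, continuous f}.

Lemma border_segments a b c d f : a <= b -> c <= d ->
  continuous_on_border a b c d f ->
  [/\ continuous_on_segment a b (fun x => f (x +i* c)%C),
      continuous_on_segment a b (fun x => f (x +i* d)%C),
      continuous_on_segment c d (fun y => f (b +i* y)%C) &
      continuous_on_segment c d (fun y => f (a +i* y)%C)].
Proof.
move=> ab cd cf; split.
- by apply: horizontal_segment => t /(horizontal_border cd)[? _]; exact: cf.
- by apply: horizontal_segment => t /(horizontal_border cd)[_ ?]; exact: cf.
- by apply: vertical_segment => t /(vertical_border ab)[? _]; exact: cf.
- by apply: vertical_segment => t /(vertical_border ab)[_ ?]; exact: cf.
Qed.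

Lemma eq_contour a b c d f g : a <= b -> c <= d ->
  (forall z, rectangle_border a b c d z -> f z = g z) ->
  contour a b c d f = contour a b c d g.
Proof.
move=> ab cd fg; rewrite /contour; congr (_ - _ + _ * (_ - _)); apply: eq_cint => t.
- by move=> /(horizontal_border cd)[? _]; exact: fg.
- by move=> /(horizontal_border cd)[_ ?]; exact: fg.
- by move=> /(vertical_border ab)[? _]; exact: fg.
- by move=> /(vertical_border ab)[_ ?]; exact: fg.
Qed.

Lemma contourB a b c d f g : a <= b -> c <= d ->
  continuous_on_border a b c d f -> continuous_on_border a b c d g ->
  contour a b c d (fun z => f z - g z) = contour a b c d f - contour a b c d g.
Proof.
move=> ab cd /border_segments-/(_ ab cd)[f1 f2 f3 f4].
move=> /border_segments-/(_ ab cd)[g1 g2 g3 g4].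
rewrite /contour !cintB//.
ring.
Qed.

Lemma contourZ a b c d (k : R[i]) f : a <= b -> c <= d ->
  continuous_on_border a b c d f ->
  contour a b c d (fun z => k * f z) = k * contour a b c d f.
Proof.
move=> ab cd /border_segments-/(_ ab cd)[f1 f2 f3 f4].
rewrite /contour !cintZ//; ring.
Qed.

Lemma contour_cst a b c d (k : R[i]) : a <= b -> c <= d ->
  contour a b c d (fun=> k) = 0.
Proof. by move=> ab cd; rewrite /contour !subrr mulr0 addr0. Qed.

Lemma contour_id a b c d : a <= b -> c <= d -> contour a b c d id = 0.
Proof.
move=> ab cd; have [|f1 f2 f3 f4] := @border_segments a b c d id ab cd.
  by move=> z _; exact: cvg_id.
rewrite /contour -!cintB//.
rewrite (@eq_cint _ _ _ _  (fun=> 'i%C * (c - d)%:C%C)); last first.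
  by move=> t _; exact: vertical_sub.
rewrite (@eq_cint _ c d _ (fun=> (b - a)%:C%C)); last first.
  by move=> t _; exact: horizontal_sub.
rewrite !cint_cst// !rmorphB/=; ring.
Qed.

(** Each side contributes 2 M times its length by [modulus_cint_le], and the sides come in parallel
    pairs; hence the factor 4. *)
Lemma modulus_contour_le a b c d f (M : R) : a <= b -> c <= d ->
  continuous_on_border a b c d f ->
  (forall z, rectangle_border a b c d z -> modulus (f z) <= M) ->
  modulus (contour a b c d f) <= 4 * M * ((b - a) + (d - c)).
Proof.
move=> ab cd /border_segments-/(_ ab cd)[f1 f2 f3 f4] fM.
have bnd u v h : u <= v -> continuous_on_segment u v h ->
    (forall t, u <= t <= v -> modulus (h t) <= M) ->
    modulus (cint u v h) <= 2 * M * (v - u) by exact: modulus_cint_le.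
rewrite /contour (le_trans (le_modulusD _ _))// modulusM modulus_i mul1r.
rewrite (le_trans (lerD (le_modulusD _ _) (le_modulusD _ _)))// !modulusN.
have -> : 4 * M * ((b - a) + (d - c)) =
  (2 * M * (b - a) + 2 * M * (b - a)) + (2 * M * (d - c) + 2 * M * (d - c)) by ring.
apply: lerD; apply: lerD; apply: bnd => // t.
- by move=> /(horizontal_border cd)[? _]; exact: fM.
- by move=> /(horizontal_border cd)[_ ?]; exact: fM.
- by move=> /(vertical_border ab)[? _]; exact: fM.
- by move=> /(vertical_border ab)[_ ?]; exact: fM.
Qed.

Lemma contour_split_Re a m b c d f : a <= m -> m <= b ->
  continuous_on_segment a b (fun x => f (x +i* c)%C) ->
  continuous_on_segment a b (fun x => f (x +i* d)%C) ->
  contour a b c d f = contour a m c d f + contour m b c d f.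
Proof. by move=> am mb f1 f2; rewrite /contour !(cint_split am mb)//; ring. Qed.

Lemma contour_split_Im a b c l d f : c <= l -> l <= d ->
  continuous_on_segment c d (fun x => f (a +i* x)%C) ->
  continuous_on_segment c d (fun x => f (b +i* x)%C) ->
  contour a b c d f = contour a b c l f + contour a b l d f.
Proof. by move=> am mb f1 f2; rewrite /contour !(cint_split am mb)//; ring. Qed.

Lemma continuous_affine (k u : R[i]) : continuous (fun z : R[i] => k + u * z).
Proof.
move=> z; apply: continuousD; first exact: cst_continuous.
by apply: continuousM; [exact: cst_continuous|exact: cvg_id].
Qed.

Lemma contour_affine a b c d (k u : R[i]) : a <= b -> c <= d ->
  contour a b c d (fun z => k + u * z) = 0.
Proof.
move=> ab cd.
rewrite (_ : (fun z => _) = (fun z => k - (- u) * z)); last first.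
  by apply/funext => z; rewrite mulNr opprK.
rewrite contourB ?contourZ ?contour_cst ?contour_id//; first by rewrite mulr0 subr0.
- by move=> z _; exact: cvg_id.
- by move=> z _; exact: cst_continuous.
- by move=> z _; apply: continuousM; [exact: cst_continuous|exact: cvg_id].
Qed.

End contour_integral.

(** * Goursat's theorem *)

Section goursat.
Context {R : realType}.
Implicit Types (a b c d : R) (f g : R[i] -> R[i]) (z : R[i]).

Lemma sub_rectangle a b c d a' b' c' d' z : a <= a' -> b' <= b -> c <= c' -> d' <= d ->
  rectangle a' b' c' d' z -> rectangle a b c d z.
Proof.
move=> aa bb cc dd /andP[/andP[z1 z2] /andP[z3 z4]].
by rewrite /rectangle (le_trans aa z1) (le_trans z2 bb) (le_trans cc z3) (le_trans z4 dd).
Qed.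

Lemma rectangle_dist a b c d z w : rectangle a b c d z -> rectangle a b c d w ->
  modulus (z - w) <= (b - a) + (d - c).
Proof.
move=> /andP[/andP[z1 z2] /andP[z3 z4]] /andP[/andP[w1 w2] /andP[w3 w4]].
rewrite (le_trans (modulus_le_ReIm _))// !raddfB lerD// ler_norml; apply/andP; split; lra.
Qed.

(** A linear map of [R[i]] into itself is multiplication by its value at 1, so [k] is the complex
    derivative. *)
Lemma differentiable_affine_approx f z : differentiable f z ->
  exists k : R[i], forall e : R, 0 < e -> exists2 r : R, 0 < r &
    forall w, modulus (w - z) < r -> modulus (f w - f z - k * (w - z)) <= e * modulus (w - z).
Proof.
move=> df; exists ('d f z 1) => e e0.
have [r r0 rP] := differentiable_modulusP df e0; exists r => // w /rP.
rewrite subrKC.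
have -> : 'd f z (w - z) = 'd f z 1 * (w - z).
  rewrite mulrC -[RHS]/((w - z) *: 'd f z 1).
  by rewrite -linearZ; congr ('d f z _); rewrite -[LHS]mulr1.
by [].
Qed.

(** With s the half-perimeter, the bound 4 e s^2 is stable under quartering: s halves, and four
    times (s/2)^2 is s^2. On a small rectangle around z the affine part of f has zero contour, and
    the rest is at most e s on a border of half-perimeter s. Then e is arbitrary. *)
Lemma goursat a b c d f : a <= b -> c <= d ->
  (forall z, rectangle a b c d z -> differentiable f z) -> contour a b c d f = 0.
Proof.
move=> ab cd df.
have cf z : rectangle a b c d z -> {for z, continuous f}.
  by move=> /df; exact: differentiable_continuous.
suff goal_le e : 0 < e -> modulus (contour a b c d f) <= 4 * e * ((b - a) + (d - c)) ^+ 2.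
  apply: modulus0_eq0; apply/eqP; rewrite eq_le modulus_ge0 andbT.
  set s := (b - a) + (d - c) in goal_le *.
  have s0 : 0 <= s by rewrite /s; lra.
  apply/ler_addgt0Pr => e e0; rewrite add0r.
  (* The [+ 1] keeps the divisor positive when the rectangle degenerates to a point. *)
  have D0 : 0 < 4 * (s ^+ 2 + 1) by rewrite mulr_gt0// ltr_wpDl// sqr_ge0.
  apply: (le_trans (goal_le (e / (4 * (s ^+ 2 + 1))) _)); first exact: divr_gt0.
  rewrite (_ : 4 * _ * _ = e * (s ^+ 2 / (s ^+ 2 + 1))); last first.
    by field; move: D0; rewrite pmulr_rgt0// => /lt0r_neq0.
  rewrite ler_piMr ?(ltW e0)// ler_pdivrMr ?mul1r ?lerDl//.
  by rewrite ltr_wpDl// sqr_ge0.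
move=> e0.
apply: (@rectangle_bisection R (fun a' b' c' d' =>
  modulus (contour a' b' c' d' f) <= 4 * e * ((b' - a') + (d' - c')) ^+ 2)) => //.
- move=> a' b' c' d' aa' ab' bb' cc' cd' dd' m l.
  have am : a' <= m by rewrite /m; lra.
  have mb : m <= b' by rewrite /m; lra.
  have cl : c' <= l by rewrite /l; lra.
  have ld : l <= d' by rewrite /l; lra.
  have hseg y : c' <= y <= d' -> continuous_on_segment a' b' (fun x => f (x +i* y)%C).
    move=> ycd; apply: horizontal_segment => x xab; apply: cf.
    by move: ycd xab => /andP[? ?] /andP[? ?]; apply/andP; split; apply/andP; split => /=; lra.
  have vseg x : a' <= x <= b' -> continuous_on_segment c' d' (fun y => f (x +i* y)%C).
    move=> ycd; apply: vertical_segment => y xab; apply: cf.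
    by move: ycd xab => /andP[? ?] /andP[? ?]; apply/andP; split; apply/andP; split => /=; lra.
  move=> P1 P2 P3 P4.
  have c'd' : c' <= d' by exact: le_trans ld.
  have a'b' : a' <= b' by exact: le_trans mb.
  have hc : c' <= c' <= d' by rewrite lexx.
  have hd : c' <= d' <= d' by rewrite lexx andbT.
  have va : a' <= a' <= b' by rewrite lexx.
  have vb : a' <= b' <= b' by rewrite lexx andbT.
  have vm : a' <= m <= b' by rewrite am.
  rewrite (contour_split_Re am mb (hseg _ hc) (hseg _ hd)).
  rewrite (contour_split_Im cl ld (vseg _ va) (vseg _ vm)).
  rewrite (contour_split_Im cl ld (vseg _ vm) (vseg _ vb)).
  apply: (le_trans (le_modulusD _ _)).
  apply: (le_trans (lerD (le_modulusD _ _) (le_modulusD _ _))).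
  apply: (le_trans (lerD (lerD P1 P3) (lerD P2 P4))).
  by rewrite le_eqVlt; apply/orP; left; apply/eqP; rewrite /m /l; field.
- move=> x y xab ycd; set z := (x +i* y)%C.
  have /differentiable_affine_approx[k kP] : differentiable f z.
    by apply: df; rewrite /rectangle/= xab.
  have [r r0 rP] := kP _ e0; exists r => // a' b' c' d' aa' bb' cc' dd' xab' ycd' sr.
  have a'b' : a' <= b' by case/andP: xab' => /le_trans; exact.
  have c'd' : c' <= d' by case/andP: ycd' => /le_trans; exact.
  have zr : rectangle a' b' c' d' z by rewrite /rectangle/= xab'.
  have subr w : rectangle a' b' c' d' w -> rectangle a b c d w by exact: sub_rectangle.
  have cfb : continuous_on_border a' b' c' d' f.
    by move=> w /andP[/subr wr _]; exact: cf.
  have -> : contour a' b' c' d' f = contour a' b' c' d' (fun w => f w - ((f z - k * z) + k * w)).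
    have caf : continuous_on_border a' b' c' d' (fun w => (f z - k * z) + k * w).
      by move=> w _; exact: continuous_affine.
    rewrite (contourB a'b' c'd' cfb caf) (contour_affine _ _ a'b' c'd').
    exact/esym/subr0.
  set s := (b' - a') + (d' - c') in sr *.
  have -> : 4 * e * s ^+ 2 = 4 * (e * s) * s by ring.
  apply: (modulus_contour_le a'b' c'd').
    by move=> w wb; apply: continuousB; [exact: cfb|exact: continuous_affine].
  move=> w /andP[wr _]; have wz := rectangle_dist wr zr.
  rewrite (_ : f w - _ = f w - f z - k * (w - z)); last by ring.
  apply: (le_trans (rP _ (le_lt_trans wz sr))); rewrite ler_wpM2l//; exact: ltW.
Qed.

(* The region between the two rectangles is cut into four rectangles. *)
Lemma contour_hole a b c d a' b' c' d' f :
  a <= a' -> a' <= b' -> b' <= b -> c <= c' -> c' <= d' -> d' <= d ->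
  (forall z, rectangle a b c d z ->
     ~~ ((a' < complex.Re z < b') && (c' < complex.Im z < d')) ->
     differentiable f z) ->
  contour a b c d f = contour a' b' c' d' f.
Proof.
move=> aa ab bb cc cd dd df.
have cf z : rectangle a b c d z ->
     ~~ ((a' < complex.Re z < b') && (c' < complex.Im z < d')) ->
     {for z, continuous f}.
  by move=> zr zn; exact/differentiable_continuous/df.
have hseg u v y : a <= u -> v <= b -> c <= y <= d -> ~~ (c' < y < d') ->
    continuous_on_segment u v (fun x => f (x +i* y)%C).
  move=> au vb yP yn; apply: horizontal_segment => x /andP[ux xv]; apply: cf => /=.
    by rewrite /rectangle/= yP (le_trans au)// (le_trans xv).
  by rewrite negb_and yn orbT.
have vseg x : a <= x <= b -> ~~ (a' < x < b') ->
    continuous_on_segment c d (fun y => f (x +i* y)%C).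
  move=> xP xn; apply: vertical_segment => y yP; apply: cf => /=.
    by rewrite /rectangle/= xP yP.
  by rewrite negb_and xn.
have a'b : a' <= b by exact: le_trans bb.
have ab' : a <= b' by exact: le_trans ab.
have c'd : c' <= d by exact: le_trans dd.
have cd' : c <= d' by exact: le_trans cd.
have cd0 : c <= d by exact: le_trans c'd.
have hc u v : a <= u -> v <= b -> continuous_on_segment u v (fun x => f (x +i* c)%C).
  by move=> au vb; apply: hseg; rewrite ?lexx ?cd0//= ltNge cc.
have hd u v : a <= u -> v <= b -> continuous_on_segment u v (fun x => f (x +i* d)%C).
  by move=> au vb; apply: hseg; rewrite ?lexx ?cd0//= negb_and -!leNgt dd orbT.
have va : continuous_on_segment c d (fun y => f (a' +i* y)%C).
  by apply: vseg; rewrite ?aa// ltxx.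
have vb : continuous_on_segment c d (fun y => f (b' +i* y)%C).
  by apply: vseg; rewrite ?ab'// ltxx andbF.
rewrite (contour_split_Re aa a'b (hc _ _ _ _) (hd _ _ _ _))//.
rewrite (contour_split_Re ab bb (hc _ _ _ _) (hd _ _ _ _))//.
rewrite (contour_split_Im cc c'd va vb).
rewrite (contour_split_Im cd dd (continuous_on_segmentS cc (lexx _) va)
  (continuous_on_segmentS cc (lexx _) vb)).
have z1 : contour a a' c d f = 0.
  apply: goursat => // z zr; apply: df; first exact: sub_rectangle zr.
  by case/andP: zr => /andP[_ h] _; rewrite negb_and negb_and -leNgt h.
have z2 : contour b' b c d f = 0.
  apply: goursat => // z zr; apply: df; first exact: sub_rectangle zr.
  by case/andP: zr => /andP[h _] _; rewrite negb_and negb_and -!leNgt h orbT.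
have z3 : contour a' b' c c' f = 0.
  apply: goursat => // z zr; apply: df; first exact: sub_rectangle zr.
  by case/andP: zr => _ /andP[_ h]; rewrite negb_and orbC negb_and -!leNgt h.
have z4 : contour a' b' d' d f = 0.
  apply: goursat => // z zr; apply: df; first exact: sub_rectangle zr.
  by case/andP: zr => _ /andP[h _]; rewrite negb_and orbC negb_and -!leNgt h orbT.
by rewrite z1 z2 z3 z4 !addr0 !add0r.
Qed.

End goursat.

(** * Cauchy's formula on a square and the second-order Taylor estimate *)

Section cauchy.
Context {R : realType}.
Implicit Types (a b c d : R) (f g : R[i] -> R[i]) (z w : R[i]).

Lemma differentiable_subV z w : w != z -> differentiable (fun x : R[i] => (x - z)^-1) w.
Proof.
move=> wz; apply: differentiableV; last by rewrite subr_eq0.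
apply: differentiableB; last exact: differentiable_cst.
by [].
Qed.

Lemma border_modulus_ge1 (r : R) z : 0 <= r ->
  rectangle_border (- r) r (- r) r z -> r <= modulus z.
Proof.
move=> r0 /andP[_ /or4P[]/eqP e].
- by rewrite (le_trans _ (Re_le_modulus _))// e normrN ger0_norm.
- by rewrite (le_trans _ (Re_le_modulus _))// e ger0_norm.
- by rewrite (le_trans _ (Im_le_modulus _))// e normrN ger0_norm.
- by rewrite (le_trans _ (Im_le_modulus _))// e ger0_norm.
Qed.

Lemma modulus_le_rectangle (r : R) z : modulus z <= r -> rectangle (- r) r (- r) r z.
Proof.
by move=> zr; rewrite /rectangle -!ler_norml (le_trans (Re_le_modulus _))// (le_trans (Im_le_modulus _)).
Qed.

(* This is 2 pi i, but only a positive lower bound on its modulus matters. *)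
Definition winding : R[i] := contour (- 1) 1 (- 1) 1 (fun z => z^-1).

Lemma differentiable_inv z : z != 0 -> differentiable (fun x : R[i] => x^-1) z.
Proof.
move=> z0; have := @differentiable_subV 0 z z0.
by rewrite (_ : (fun x => _) = (fun x : R[i] => x^-1))//; apply/funext => x; rewrite subr0.
Qed.

Lemma continuous_inv z : z != 0 -> {for z, continuous (fun x : R[i] => x^-1)}.
Proof. by move=> /differentiable_inv; exact: differentiable_continuous. Qed.

Lemma modulus_winding : 4 <= modulus winding.
Proof.
have n10 : (-1 : R) <= 1 by lra.
have nz z : rectangle_border (-1) 1 (-1) 1 z -> z != 0.
  move=> /(border_modulus_ge1 ler01); apply: contraTneq => ->.
  by rewrite modulus0 -ltNge.
have cV : continuous_on_border (-1) 1 (-1) 1 (fun z : R[i] => z^-1).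
  by move=> z /nz; exact: continuous_inv.
have [f1 f2 f3 f4] := border_segments n10 n10 cV.
(* On the four sides of the square the integrands add up to 4i/(t^2+1). *)
pose h (t : R) : R[i] := 'i%C * (4 / (t ^+ 2 + 1))%:C%C.
have f34 : continuous_on_segment (-1) 1 (fun y : R => (1 +i* y)%C^-1 - (-1 +i* y)%C^-1).
  by move=> t tab; exact: (cvgB (f3 t tab) (f4 t tab)).
have f12 : continuous_on_segment (-1) 1 (fun x : R => (x +i* (-1))%C^-1 - (x +i* 1)%C^-1).
  by move=> t tab; exact: (cvgB (f1 t tab) (f2 t tab)).
have f34i : continuous_on_segment (-1) 1 (fun y : R => 'i%C * ((1 +i* y)%C^-1 - (-1 +i* y)%C^-1)).
  by move=> t tab; exact: (cvgM (cvg_cst _) (f34 t tab)).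
have hE : (fun t : R => ((t +i* (-1))%C^-1 - (t +i* 1)%C^-1) +
    'i%C * ((1 +i* t)%C^-1 - (-1 +i* t)%C^-1)) = h.
  apply/funext => t; rewrite /h.
  have t1 : t ^+ 2 + 1 != 0 by rewrite gt_eqF// ltr_wpDl ?sqr_ge0.
  by apply/eqP; rewrite eq_complex; apply/andP; split; apply/eqP => /=;
    field; rewrite ?t1 //; nra.
have ch : continuous_on_segment (-1) 1 h.
  by rewrite -hE => t tab; exact: (cvgD (f12 t tab) (f34i t tab)).
have -> : winding = cint (-1) 1 h.
  by rewrite /winding /contour -(cintB f1 f2) -(cintB f3 f4) -(cintZ _ f34) -(cintD f12 f34i) hE.
rewrite (le_trans _ (Im_le_modulus _))// (le_trans _ (ler_norm _))// /cint.
have [_ ih] := integrable_ReIm ch.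
(* On [-1, 1] the integrand 4 / (t^2 + 1) is at least 2, and the interval has length 2. *)
have -> : (4 : R) = \int[lebesgue_measure]_(t in `[(-1)%R, 1%R]) (2 : R).
  by rewrite Rintegral_itv_cst//; ring.
apply: le_Rintegral => //.
  apply: continuous_compact_integrable; first exact: segment_compact.
  by apply: continuous_subspaceT => t; exact: cvg_cst.
move=> t; rewrite /= in_itv/= => /andP[t0 t1].
rewrite mul0r add0r mul1r ler_pdivlMr ?ltr_wpDl ?sqr_ge0//; nra.
Qed.

Lemma winding_neq0 : winding != 0.
Proof.
by apply: contraTneq modulus_winding => ->; rewrite modulus0 -ltNge; lra.
Qed.

Lemma modulus_invVsub z w : modulus z <= 2^-1 -> 1 <= modulus w ->
  modulus ((w - z)^-1) <= 2 * (modulus w)^-1.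
Proof.
move=> z2 w1; have := lerB_modulus w z; set u := modulus w in w1 *.
rewrite modulusV => uz; have w0 : 0 < modulus (w - z) by lra.
rewrite ler_pdivlMr; last by lra.
rewrite mulrC ler_pdivrMr//; lra.
Qed.

(** The kernels at z and at 0 differ by O(|w|^-2). By [contour_hole] the square may be enlarged to
    half-side r without changing the contour of the difference, which is then at most 16 / r for
    every large r, hence zero. *)
Lemma contour_subV z : modulus z <= 2^-1 ->
  contour (-1) 1 (-1) 1 (fun w => (w - z)^-1) = winding.
Proof.
move=> z2; have n10 : (-1 : R) <= 1 by lra.
pose q (w : R[i]) : R[i] := (w - z)^-1 - w^-1.
have dq w : ~~ ((- 1 < complex.Re w < 1) && (- 1 < complex.Im w < 1)) ->
    differentiable q w.
  move=> wn; apply: differentiableB.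
    apply: differentiable_subV; apply: contraNneq wn => ->.
    rewrite -!ltr_norml (le_lt_trans (Re_le_modulus _)) ?(le_lt_trans (Im_le_modulus _))//; lra.
  apply: differentiable_inv; apply: contraNneq wn => -> /=.
  by rewrite ltr01 oppr_lt0 ltr01.
have cV0 w : rectangle_border (-1) 1 (-1) 1 w -> w != 0.
  move=> /(border_modulus_ge1 ler01); apply: contraTneq => ->.
  by rewrite modulus0 -ltNge.
have cV : continuous_on_border (-1) 1 (-1) 1 (fun z : R[i] => z^-1).
  by move=> w /cV0; exact: continuous_inv.
have cVz : continuous_on_border (-1) 1 (-1) 1 (fun w : R[i] => (w - z)^-1).
  move=> w /(border_modulus_ge1 ler01) w1; apply: differentiable_continuous.
  apply: differentiable_subV; apply: contraTneq w1 => ->; rewrite -ltNge; lra.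
apply/eqP; rewrite -subr_eq0 /winding -(contourB n10 n10 cVz cV); apply/eqP.
apply: modulus0_eq0; apply/eqP; rewrite eq_le modulus_ge0 andbT.
apply/ler_addgt0Pr => e e0; rewrite add0r.
pose r := 1 + 32 / e.
have r1 : 1 <= r by rewrite lerDl divr_ge0// ltW.
have nrr : - r <= r by lra.
have r0 : 0 < r by lra.
have -> : contour (-1) 1 (-1) 1 (fun w => (w - z)^-1 - w^-1) = contour (- r) r (- r) r q.
  have nr1 : - r <= - 1 by rewrite lerN2.
  apply: esym; apply: (contour_hole nr1 n10 r1 nr1 n10 r1) => w _; exact: dq.
have hb : modulus (contour (- r) r (- r) r q) <= 4 * (r ^- 2) * ((r - - r) + (r - - r)).
  apply: (modulus_contour_le nrr nrr) => w wb.
    apply/differentiable_continuous/dq.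
    case/andP: wb => _ /or4P[]/eqP ->; rewrite ?ltr_norml; lra.
  have wr := border_modulus_ge1 (ltW r0) wb.
  have w1 : 1 <= modulus w by lra.
  have w0 : w != 0 by apply: contraTneq w1 => ->; rewrite modulus0; lra.
  have wz : w - z != 0.
    rewrite subr_eq0; apply: contraTneq w1 => ->; lra.
  have -> : q w = z * ((w - z)^-1 * w^-1) by rewrite /q; field; rewrite w0 wz.
  rewrite !modulusM (modulusV w).
  have h1 := modulus_invVsub z2 w1.
  have h3 : (modulus w)^-1 <= r^-1 by rewrite lef_pV2 ?posrE//; lra.
  have h4 : 0 <= (modulus w)^-1 by rewrite invr_ge0 modulus_ge0.
  have h5 : modulus (w - z)^-1 <= 2 * r^-1 by lra.
  apply: (@le_trans _ _ (2^-1 * ((2 * r^-1) * r^-1))).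
    apply: ler_pM; rewrite ?modulus_ge0 ?mulr_ge0 ?modulus_ge0//.
    by apply: ler_pM => //; exact: modulus_ge0.
  by rewrite -exprVn (_ : 2^-1 * _ = r^-1 ^+ 2)//; field; lra.
apply: (le_trans hb).
rewrite (_ : 4 * _ * _ = 16 / r); last by field; lra.
rewrite ler_pdivrMr// /r mulrDr mulr1 mulrCA divff ?gt_eqF// mulr1; lra.
Qed.

(** The quotient [q] is bounded near z by differentiability, so its contour vanishes once the square
    is shrunk to z. What remains is [g z] times the contour of the kernel. *)
Lemma cauchy_formula g z : modulus z <= 2^-1 ->
  (forall w, rectangle (-1) 1 (-1) 1 w -> differentiable g w) ->
  contour (-1) 1 (-1) 1 (fun w => g w * (w - z)^-1) = winding * g z.
Proof.
move=> z2 dg; have n10 : (-1 : R) <= 1 by lra.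
have zr w : modulus (w - z) <= 2^-1 -> rectangle (-1) 1 (-1) 1 w.
  move=> wz; apply: modulus_le_rectangle; have := lerB_modulus w z.
  move: z2 wz; set u := modulus w; set v := modulus z; lra.
pose q w := (g w - g z) * (w - z)^-1.
have dq w : rectangle (-1) 1 (-1) 1 w -> w != z -> differentiable q w.
  move=> wr wz; apply: differentiableM; last exact: differentiable_subV.
  by apply: differentiableB; [exact: dg|exact: differentiable_cst].
have bz w : rectangle_border (-1) 1 (-1) 1 w -> w != z.
  move=> /(border_modulus_ge1 ler01); apply: contraTneq => ->; rewrite -ltNge (le_lt_trans z2)//; lra.
have cq : continuous_on_border (-1) 1 (-1) 1 q.
  move=> w wb; apply: differentiable_continuous; apply: dq; last exact: bz.
  by case/andP: wb.
have cV : continuous_on_border (-1) 1 (-1) 1 (fun w => (w - z)^-1).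
  by move=> w /bz wz; apply: differentiable_continuous; exact: differentiable_subV.
suff q0 : contour (-1) 1 (-1) 1 q = 0.
  have cgV : continuous_on_border (-1) 1 (-1) 1 (fun w => - g z * (w - z)^-1).
    by move=> w wb; apply: continuousM; [exact: cst_continuous|exact: cV].
  transitivity (contour (-1) 1 (-1) 1 (fun w => q w - (- g z * (w - z)^-1))).
    apply: eq_contour => // w _; rewrite /q; ring.
  rewrite (contourB n10 n10 cq cgV) q0 (contourZ _ n10 n10 cV) contour_subV//; ring.
have zz : modulus (z - z) <= 2^-1 by rewrite subrr modulus0 invr_ge0.
have [k kP] := differentiable_affine_approx (dg z (zr z zz)).
have [r r0 rP] := kP 1 ltr01.
have qK w : modulus (w - z) < r -> modulus (q w) <= modulus k + 1.
  move=> wr; have [->|wz] := eqVneq w z.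
    by rewrite /q subrr mul0r modulus0 addr_ge0 ?modulus_ge0.
  have wz0 : 0 < modulus (w - z) by rewrite modulus_gt0// subr_eq0.
  rewrite /q modulusM modulusV ler_pdivrMr//.
  have := rP w wr; rewrite mul1r => h.
  have -> : g w - g z = (g w - g z - k * (w - z)) + k * (w - z) by rewrite subrK.
  rewrite (le_trans (le_modulusD _ _))// modulusM mulrDl mul1r addrC lerD2l//.
apply: modulus0_eq0; apply/eqP; rewrite eq_le modulus_ge0 andbT.
apply/ler_addgt0Pr => e e0; rewrite add0r.
pose K := modulus k + 1; have K1 : 1 <= K by rewrite lerDr modulus_ge0.
(* The three bounds keep the small square inside the unit one (as |z| <= 1/2), keep it within
   distance r of z, where [K] bounds [q], and make the final estimate 16 K s at most e. *)
pose s := Num.min (2^-1) (Num.min (r / 8) (e / (16 * K))).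
have s0 : 0 < s by rewrite !lt_min invr_gt0 ltr0n !divr_gt0//; lra.
have s2 : s <= 2^-1 by rewrite ge_min lexx.
have sr : s <= r / 8 by rewrite /s !ge_min lexx !orbT.
have se : s <= e / (16 * K) by rewrite /s !ge_min lexx !orbT.
have Rez := le_trans (Re_le_modulus z) z2.
have Imz := le_trans (Im_le_modulus z) z2.
move: Rez Imz; rewrite !ler_norml => /andP[x1 x2] /andP[y1 y2].
set x := complex.Re z in x1 x2 *; set y := complex.Im z in y1 y2 *.
have a1 : -1 <= x - s by lra.
have a2 : x - s <= x + s by lra.
have a3 : x + s <= 1 by lra.
have b1 : -1 <= y - s by lra.
have b2 : y - s <= y + s by lra.
have b3 : y + s <= 1 by lra.
have zin : (x - s < x < x + s) && (y - s < y < y + s).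
  by rewrite !ltrBlDr !ltrDl s0.
rewrite (contour_hole a1 a2 a3 b1 b2 b3); last first.
  move=> w wr wn; apply: dq => //; apply: contraNneq wn => ->; exact: zin.
have zs : rectangle (x - s) (x + s) (y - s) (y + s) z.
  by rewrite /rectangle -/x -/y; case/andP: zin => /andP[/ltW -> /ltW ->] /andP[/ltW -> /ltW ->].
have bound : modulus (contour (x - s) (x + s) (y - s) (y + s) q) <=
    4 * K * ((x + s) - (x - s) + ((y + s) - (y - s))).
  apply: (modulus_contour_le a2 b2).
    move=> w wb; apply: differentiable_continuous; apply: dq.
      by case/andP: wb => /(sub_rectangle a1 a3 b1 b3).
    apply: contraTneq wb => ->; rewrite negb_and; apply/orP; right.
    by rewrite -/x -/y !negb_or; apply/and4P; split; rewrite neq_lt ?ltrBlDr ?ltrDl s0 ?orbT.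
  move=> w /andP[ws _]; apply: qK.
  by rewrite (le_lt_trans (rectangle_dist ws zs))//; lra.
apply: (le_trans bound).
rewrite (_ : 4 * K * _ = s * (16 * K)); last by ring.
by rewrite -ler_pdivlMr//; lra.
Qed.

(** Combining Cauchy's formula at z and at 0 uses 1/(w - z) - 1/w - z/w^2 = z^2 / (w^2 (w - z)): the
    remainder is z^2 times a contour with integrand at most 2 M, and [k] is the derivative at 0. The
    contours are at most 16 M and 32 M |z|^2, and division by [winding], of modulus at least 4,
    gives the constants. *)
Lemma cauchy_taylor g (M : R) :
  (forall w, rectangle (-1) 1 (-1) 1 w -> differentiable g w) ->
  (forall w, rectangle (-1) 1 (-1) 1 w -> modulus (g w) <= M) ->
  exists2 k : R[i], modulus k <= 4 * M & forall z, modulus z <= 2^-1 ->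
    modulus (g z - g 0 - k * z) <= 8 * M * modulus z ^+ 2.
Proof.
move=> dg gM; have n10 : (-1 : R) <= 1 by lra.
have M0 : 0 <= M.
  rewrite (le_trans (modulus_ge0 (g 0)))// gM//; apply: modulus_le_rectangle.
  by rewrite modulus0.
have W0 : 0 < modulus winding by rewrite (lt_le_trans _ modulus_winding).
have cg : continuous_on_border (-1) 1 (-1) 1 g.
  by move=> w /andP[wr _]; apply: differentiable_continuous; exact: dg.
have bV w : rectangle_border (-1) 1 (-1) 1 w -> w != 0.
  move=> /(border_modulus_ge1 ler01); apply: contraTneq => ->.
  by rewrite modulus0 -ltNge.
have cV : continuous_on_border (-1) 1 (-1) 1 (fun w => w^-1).
  by move=> w /bV; exact: continuous_inv.
have bz z w : modulus z <= 2^-1 -> rectangle_border (-1) 1 (-1) 1 w -> w != z.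
  move=> z2 /(border_modulus_ge1 ler01); apply: contraTneq => ->.
  by rewrite -ltNge (le_lt_trans z2)// invf_lt1 ?ltr1n.
have cVz z : modulus z <= 2^-1 -> continuous_on_border (-1) 1 (-1) 1 (fun w => (w - z)^-1).
  by move=> z2 w /(bz _ _ z2) wz; apply: differentiable_continuous; exact: differentiable_subV.
have cM (f h : R[i] -> R[i]) : continuous_on_border (-1) 1 (-1) 1 f ->
    continuous_on_border (-1) 1 (-1) 1 h ->
    continuous_on_border (-1) 1 (-1) 1 (fun w => f w * h w).
  by move=> cf ch w wb; apply: continuousM; [exact: cf|exact: ch].
have cK (k : R[i]) : continuous_on_border (-1) 1 (-1) 1 (fun=> k).
  by move=> w _; exact: cst_continuous.
pose A := contour (-1) 1 (-1) 1 (fun w => g w * (w^-1 * w^-1)).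
have cA : continuous_on_border (-1) 1 (-1) 1 (fun w => g w * (w^-1 * w^-1)).
  by apply: (cM _ _ cg); exact: cM.
have Vle1 w : rectangle_border (-1) 1 (-1) 1 w -> modulus w^-1 <= 1.
  by move=> wb; rewrite modulusV invf_le1 ?modulus_gt0 ?bV// border_modulus_ge1.
exists (winding^-1 * A).
  rewrite modulusM modulusV mulrC ler_pdivrMr//.
  have := @modulus_contour_le _ _ _ _ _ _ M n10 n10 cA; rewrite -/A => hA.
  apply: (@le_trans _ _ (4 * M * 4)).
    rewrite (_ : 4 * M * 4 = 4 * M * (1 - -1 + (1 - -1))); last by ring.
    apply: hA => w wb; rewrite !modulusM -[leRHS]mulr1.
    apply: ler_pM; rewrite ?mulr_ge0 ?modulus_ge0//; first by apply: gM; case/andP: wb.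
    by rewrite -[leRHS]mulr1; apply: ler_pM; rewrite ?modulus_ge0 ?Vle1.
  by rewrite ler_wpM2l ?modulus_winding// mulr_ge0.
move=> z z2.
have z0 : modulus (0 : R[i]) <= 2^-1 by rewrite modulus0 invr_ge0.
rewrite -(ler_pM2l W0) -modulusM.
have -> : winding * (g z - g 0 - winding^-1 * A * z) =
    contour (-1) 1 (-1) 1 (fun w => (z * z) * (g w * ((w^-1 * w^-1) * (w - z)^-1))).
  transitivity (winding * g z - winding * g 0 - z * A).
    by field; exact: winding_neq0.
  rewrite -(cauchy_formula z2 dg) -(cauchy_formula z0 dg) /A.
  have c1 := cM _ _ cg (cVz _ z2); have c2 := cM _ _ cg (cVz _ z0).
  have c3 := cM _ _ (cK z) cA.
  have c12 : continuous_on_border (-1) 1 (-1) 1 (fun w => g w * (w - z)^-1 - g w * (w - 0)^-1).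
    by move=> w wb; apply: continuousB; [exact: c1|exact: c2].
  rewrite -(contourB n10 n10 c1 c2) -(contourZ z n10 n10 cA) -(contourB n10 n10 c12 c3).
  apply: eq_contour => // w wb; have w0 := bV _ wb; have wz := bz _ _ z2 wb.
  by field; rewrite ?subr0 ?w0 ?subr_eq0 ?wz.
have -> : modulus winding * (8 * M * modulus z ^+ 2) = modulus winding * 8 * M * modulus z ^+ 2.
  by rewrite !mulrA.
have cc : continuous_on_border (-1) 1 (-1) 1
    (fun w => (z * z) * (g w * ((w^-1 * w^-1) * (w - z)^-1))).
  exact: (cM _ _ (cK (z * z)) (cM _ _ cg (cM _ _ (cM _ _ cV cV) (cVz z z2)))).
have bound : forall w, rectangle_border (-1) 1 (-1) 1 w ->
    modulus ((z * z) * (g w * ((w^-1 * w^-1) * (w - z)^-1))) <= 2 * M * modulus z ^+ 2.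
  move=> w wb; rewrite !modulusM -expr2 mulrC ler_wpM2r ?sqr_ge0// mulrC.
  have w1 := border_modulus_ge1 ler01 wb.
  have v1 := Vle1 w wb.
  have v2 : modulus (w - z)^-1 <= 2.
    by rewrite (le_trans (modulus_invVsub z2 w1))// -[leRHS]mulr1 ler_wpM2l// -modulusV.
  have h : modulus w^-1 * modulus w^-1 <= 1.
    by rewrite -[leRHS]mulr1; apply: ler_pM; rewrite ?modulus_ge0.
  apply: ler_pM; rewrite ?mulr_ge0 ?modulus_ge0//.
    by rewrite -[leRHS]mul1r; apply: ler_pM; rewrite ?mulr_ge0 ?modulus_ge0.
  by apply: gM; case/andP: wb.
apply: (le_trans (modulus_contour_le n10 n10 cc bound)).
rewrite (_ : 4 * _ * _ = 4 * 8 * M * modulus z ^+ 2); last by ring.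
by rewrite ler_wpM2r ?sqr_ge0// ler_wpM2r// ler_wpM2r ?modulus_winding.
Qed.

End cauchy.

(** * Holomorphic functions on normed spaces *)

Section several_variables.
Context {R : realType} {V : normedModType R[i]}.
Implicit Types (f : V -> R[i]) (z v h : V).

Lemma differentiable_line f z v (a : R[i]) : differentiable f (z + a *: v) ->
  differentiable (fun b : R[i] => f (z + b *: v)) a.
Proof.
by move=> df; apply: (@differentiable_comp _ _ _ _ (fun b : R[i] => z + b *: v) f) => //.
Qed.

(** Uniqueness of the derivative along a line, tested at one small real parameter [t]: the two
    expansions at [t] differ by ('d f z v - k) t, which is made at most e t. *)
Lemma diff_line f z v (k : R[i]) (C : R) : differentiable f z ->
  (forall a : R[i], modulus a <= 2^-1 ->
    modulus (f (z + a *: v) - f z - k * a) <= C * modulus a ^+ 2) ->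
  'd f z v = k.
Proof.
move=> df fk; apply/eqP; rewrite -subr_eq0; apply/eqP/modulus0_eq0/eqP.
rewrite eq_le modulus_ge0 andbT; apply/ler_addgt0Pr => e e0; rewrite add0r.
have v1 : 0 < modulus v + 1 by rewrite ltr_wpDl ?modulus_ge0.
have C1 : 0 < `|C| + 1 by rewrite ltr_wpDl.
have ev : 0 < e / 2 / (modulus v + 1) by rewrite !divr_gt0.
have [r r0 rP] := differentiable_modulusP df ev.
pose t : R := Num.min (2^-1) (Num.min (r / 2 / (modulus v + 1)) (e / 2 / (`|C| + 1))).
have t0 : 0 < t by rewrite !lt_min invr_gt0 ltr0n !divr_gt0.
have t1 : t <= 2^-1 by rewrite ge_min lexx.
have tr : t <= r / 2 / (modulus v + 1) by rewrite /t !ge_min lexx !orbT.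
have tC : t <= e / 2 / (`|C| + 1) by rewrite /t !ge_min lexx !orbT.
have tm : modulus (t%:C%C : R[i]) = t by rewrite modulusR gtr0_norm.
have h1 : modulus (f (z + t%:C%C *: v) - f z - k * t%:C%C) <= C * t ^+ 2.
  by have := fk t%:C%C; rewrite tm; exact.
have tv : modulus (t%:C%C *: v) = t * modulus v by rewrite modulusZ tm.
have h2 : modulus (f (z + t%:C%C *: v) - f z - 'd f z (t%:C%C *: v)) <= e / 2 * t.
  apply: (le_trans (rP _ _)); rewrite tv.
    move: tr; rewrite ler_pdivlMr// mulrDr mulr1; have := modulus_ge0 v.
    move: t0 r0; set u := t * _; lra.
  rewrite (_ : _ * (t * _) = e / 2 * t * (modulus v / (modulus v + 1))); last first.
    by field; rewrite gt_eqF.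
  by rewrite ler_piMr ?mulr_ge0 ?divr_ge0 ?ltW// ltr_pdivrMr// mul1r ltrDl.
have E : ('d f z v - k) * t%:C%C =
    (f (z + t%:C%C *: v) - f z - k * t%:C%C) -
    (f (z + t%:C%C *: v) - f z - 'd f z (t%:C%C *: v)).
  have -> : 'd f z (t%:C%C *: v) = t%:C%C * 'd f z v by exact: linearZ.
  ring.
have : modulus (('d f z v - k) * t%:C%C) <= e * t.
  rewrite E (le_trans (le_modulusD _ _))// modulusN (le_trans (lerD h1 h2))//.
  rewrite [e in leRHS]splitr [leRHS]mulrDl lerD2r expr2 mulrA ler_wpM2r ?(ltW t0)//.
  have : C * t <= (`|C| + 1) * t by rewrite ler_wpM2r ?(ltW t0)// ler_wpDr// ler_norm.
  by move/le_trans; apply; rewrite mulrC -ler_pdivlMr.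
by rewrite modulusM tm ler_pM2r.
Qed.

(* One-variable Taylor estimate along the line through [z] in the direction [h],
   rescaled so that the square [-1, 1]^2 stays in the ball of radius [r]. *)
Lemma holomorphic_taylor f z (r M : R) : 0 < r ->
  (forall w, modulus (w - z) <= r -> differentiable f w) ->
  (forall w, modulus (w - z) <= r -> modulus (f w) <= M) ->
  (forall h, modulus ('d f z h) <= 8 * M * (modulus h / r)) /\
  (forall h, modulus h <= r / 4 ->
     modulus (f (z + h) - f z - 'd f z h) <= 32 * M * (modulus h / r) ^+ 2).
Proof.
move=> r0 df fM.
have dfz : differentiable f z by apply: df; rewrite subrr modulus0 ltW.
suff main h : h != 0 -> modulus ('d f z h) <= 8 * M * (modulus h / r) /\
    (modulus h <= r / 4 ->
     modulus (f (z + h) - f z - 'd f z h) <= 32 * M * (modulus h / r) ^+ 2).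
  split=> h; have [->|h0] := eqVneq h 0.
  - by rewrite linear0 !modulus0 mul0r mulr0.
  - by have [] := main h h0.
  - by rewrite addr0 linear0 subrr subr0 !modulus0 mul0r expr0n/= mulr0.
  - by have [] := main h h0.
move=> h0; have hp : 0 < modulus h by exact: modulus_gt0.
pose t : R := 2 * modulus h / r.
have t0 : 0 < t by rewrite divr_gt0// mulr_gt0.
have tm : modulus (t%:C%C : R[i]) = t by rewrite modulusR gtr0_norm.
have tC0 : (t%:C%C : R[i]) != 0 by apply: contra_eq_neq tm => ->; rewrite modulus0 lt_eqF.
pose v : V := (t%:C%C)^-1 *: h.
have vm : modulus v = r / 2.
  by rewrite /v modulusZ modulusV tm /t; field; rewrite ?gt_eqF.
have hv : h = t%:C%C *: v by rewrite /v scalerA mulfV// scale1r.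
have seg (a : R[i]) : rectangle (-1) 1 (-1) 1 a -> modulus ((z + a *: v) - z) <= r.
  move=> /andP[]; rewrite -!ler_norml => a1 a2.
  rewrite addrAC subrr add0r modulusZ vm.
  have : modulus a <= 2.
    by rewrite (le_trans (modulus_le_ReIm _))// (le_trans (lerD a1 a2))//; lra.
  by move=> a3; rewrite mulrA ler_pdivrMr// mulrC ler_wpM2l// ltW.
have [|a ar|k kM kP] := @cauchy_taylor R (fun b => f (z + b *: v)) M.
- by move=> a /seg/df; exact: differentiable_line.
- exact/fM/seg.
have dk : 'd f z v = k.
  apply: (@diff_line f z v k (8 * M) dfz) => a /kP.
  by rewrite scale0r addr0.
have dh : 'd f z h = t%:C%C * k by rewrite -dk {1}hv; exact: linearZ.
split.
  rewrite dh modulusM tm; apply: (@le_trans _ _ (t * (4 * M))).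
    by rewrite ler_pM2l.
  by rewrite /t le_eqVlt; apply/orP; left; apply/eqP; field; rewrite gt_eqF.
move=> hr; have t2 : t <= 2^-1 by rewrite /t ler_pdivrMr//; lra.
have := kP t%:C%C; rewrite tm => /(_ t2); rewrite scale0r addr0 -hv mulrC -dh.
move=> /le_trans; apply.
by rewrite /t le_eqVlt; apply/orP; left; apply/eqP; field; rewrite gt_eqF.
Qed.

Lemma holomorphic_lipschitz f z (r M : R) : 0 < r ->
  (forall w, modulus (w - z) <= r -> differentiable f w) ->
  (forall w, modulus (w - z) <= r -> modulus (f w) <= M) ->
  forall h, modulus h <= r / 4 -> modulus (f (z + h) - f z) <= 16 * M * (modulus h / r).
Proof.
move=> r0 df fM h hr; have [t1 t2] := holomorphic_taylor r0 df fM.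
have M0 : 0 <= M by rewrite (le_trans (modulus_ge0 (f z)))// fM// subrr modulus0 ltW.
rewrite -[X in modulus X](subrK ('d f z h)).
rewrite (le_trans (le_modulusD _ _))//.
have := t2 h hr; have := t1 h; set u := modulus h / r => h1 h2.
have u0 : 0 <= u by rewrite divr_ge0 ?modulus_ge0 ?ltW.
have u4 : u <= 4^-1 by rewrite /u ler_pdivrMr// mulrC.
(* Since u <= 1/4, the quadratic remainder is no larger than the bound 8 M u on the linear term. *)
have h3 : 32 * M * u ^+ 2 <= 8 * M * u.
  rewrite expr2 mulrA ler_wpM2r// (_ : 32 * M * u = 8 * M * (4 * u)); last by ring.
  rewrite -[leRHS]mulr1 ler_wpM2l ?mulr_ge0//; lra.
rewrite (_ : 16 * M * u = 8 * M * u + 8 * M * u); last by ring.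
by apply: lerD => //; apply: le_trans h3.
Qed.

End several_variables.

(** * Sequences in complex normed spaces *)

Section limits.
Context {R : realType}.
Implicit Types (a b : nat -> R[i]).

Lemma cvg_modulus {V : normedModType R[i]} (a : nat -> V) l :
  a k @[k --> \oo] --> l -> modulus (a k) @[k --> \oo] --> modulus l.
Proof.
move=> /cvg_modulusP al; apply/cvgrPdist_lt => e e0; near=> k.
have : modulus (a k - l) < e by near: k; exact: al.
apply: le_lt_trans; rewrite ler_norml; apply/andP; split.
  by rewrite lerNl opprB lerB_modulus.
by rewrite modulusB lerB_modulus.
Unshelve. all: by end_near. Qed.

Lemma modulus_cvg_le {V : normedModType R[i]} (a : nat -> V) l (C : R) :
  a k @[k --> \oo] --> l -> (\forall k \near \oo, modulus (a k) <= C) -> modulus l <= C.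
Proof.
by move=> /cvg_modulus al aC; apply: (ler_cvg_to al (cvg_cst C)).
Qed.

Lemma complex_cvg_unique a (l l' : R[i]) :
  a k @[k --> \oo] --> l -> a k @[k --> \oo] --> l' -> l = l'.
Proof. by apply: cvg_unique; exact: norm_hausdorff. Qed.

Lemma complex_complete a :
  (forall e : R, 0 < e -> exists N, forall k l, (N <= k)%N -> (N <= l)%N ->
    modulus (a k - a l) <= e) -> exists l : R[i], a k @[k --> \oo] --> l.
Proof.
move=> ca.
have real_complete (u : nat -> R) : (forall k l, `|u k - u l| <= modulus (a k - a l)) ->
    exists l : R, u k @[k --> \oo] --> l.
  move=> ua; suff : cvg (u k @[k --> \oo]) by move=> cu; exists (lim (u k @[k --> \oo])).
  apply: cauchy_cvg; apply: cauchy_exP => e e0.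
  have [|N NP] := ca (e / 2); first by rewrite divr_gt0.
  exists (u N); suff : \forall k \near \oo, ball (u N) e (u k) by [].
  near=> k; rewrite -ball_normE/= (le_lt_trans (ua N k))//.
  rewrite (@le_lt_trans _ _ (e / 2))//; last by lra.
  by apply: NP => //; near: k; exact: nbhs_infty_ge.
have [k l|x ax] := real_complete (fun k => complex.Re (a k)).
  by rewrite -raddfB; exact: Re_le_modulus.
have [k l|y ay] := real_complete (fun k => complex.Im (a k)).
  by rewrite -raddfB; exact: Im_le_modulus.
exists (x +i* y)%C; apply/cvg_modulusP => e e0.
have e2 : 0 < e / 2 by rewrite divr_gt0.
near=> k; apply: (le_lt_trans (modulus_le_ReIm _)).
rewrite !raddfB/= [ltRHS]splitr ltrD//.
  by rewrite distrC; near: k; exact: cvgr_dist_lt.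
by rewrite distrC; near: k; exact: cvgr_dist_lt.
Unshelve. all: by end_near. Qed.

Lemma linear_modulus_continuous {V : normedModType R[i]} (L : {linear V -> R[i]}) (C : R) :
  (forall h, modulus (L h) <= C * modulus h) -> continuous L.
Proof.
move=> LC; apply/linear_bounded_continuous.
have C1 : 0 < `|C| + 1 by rewrite ltr_wpDl.
apply/ex_bound; exists (`|C| + 1)%:C%C.
apply/nbhs_modulusP; exists 1 => // h; rewrite subr0 => h1 /=.
rewrite normr_modulus lecR (le_trans (LC h))//.
apply: (@le_trans _ _ (`|C| * 1)); last by rewrite mulr1 lerDl.
rewrite (le_trans (ler_norm _))// normrM (ger0_norm (modulus_ge0 h)).
by rewrite ler_wpM2l// ltW.
Qed.

End limits.

(** * Uniform limits of differentiable functions *)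

Section uniform_limit.
Context {R : realType} {V : normedModType R[i]}.

(** Everything is measured from one [f_ N] with |f_k - f_N| <= 1 on the ball. The Taylor estimate
    for differences makes their differentials at z Cauchy, and its remainder bound is uniform in k,
    so it survives the limit and exhibits [L] as the differential of f - f_N. *)
Lemma differentiable_uniform_limit (f_ : nat -> V -> R[i]) (f : V -> R[i]) (z : V) (r : R) :
  0 < r -> (forall k w, modulus (w - z) <= r -> differentiable (f_ k) w) ->
  (forall e : R, 0 < e -> exists N, forall k l, (N <= k)%N -> (N <= l)%N ->
    forall w, modulus (w - z) <= r -> modulus (f_ k w - f_ l w) <= e) ->
  (forall w, modulus (w - z) <= r -> f_ k w @[k --> \oo] --> f w) ->
  differentiable f z.
Proof.
move=> r0 df uc fl.
pose d k l (w : V) := f_ k w - f_ l w.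
have dd k l w : modulus (w - z) <= r -> differentiable (d k l) w.
  by move=> wr; apply: differentiableB; exact: df.
have zr : modulus (z - z) <= r by rewrite subrr modulus0 ltW.
have [Lk diffd] : exists Lk : nat -> {linear V -> R[i]},
    forall k l h, 'd (d k l) z h = Lk k h - Lk l h.
  exists (fun k => 'd (f_ k) z) => k l h.
  exact: (congr1 (fun F : V -> R[i] => F h) (diffB (df k z zr) (df l z zr))).
have [N NP] := uc 1 ltr01.
have tay e k l : (forall w, modulus (w - z) <= r -> modulus (d k l w) <= e) ->
    _ := holomorphic_taylor r0 (dd k l).
have cauchyL h : exists l : R[i], (Lk k h - Lk N h) @[k --> \oo] --> l.
  apply: complex_complete => e e0.
  have u0 : 0 <= modulus h / r by rewrite divr_ge0 ?modulus_ge0 ?ltW.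
  set u := modulus h / r in u0.
  have u1 : 0 < u + 1 by rewrite ltr_wpDl.
  have [|N' N'P] := uc (e / (8 * (u + 1))); first by rewrite divr_gt0 ?mulr_gt0.
  exists N' => k l kN lN; rewrite opprB addrA subrK -diffd.
  have [h1 _] := tay _ _ _ (N'P k l kN lN); rewrite (le_trans (h1 h))// -/u.
  rewrite (_ : _ * u = e * (u / (u + 1))); last by field; rewrite gt_eqF.
  by rewrite ler_piMr ?(ltW e0)// ler_pdivrMr// mul1r lerDl.
have {cauchyL}[L LP] := choice cauchyL.
have Llin : linear L.
  move=> a u v.
  have E : (fun k => Lk k (a *: u + v) - Lk N (a *: u + v)) =
      (fun k => a * (Lk k u - Lk N u) + (Lk k v - Lk N v)).
    apply/funext => k; have lk l : Lk l (a *: u + v) = a * Lk l u + Lk l v by exact: linearP.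
    rewrite !lk; ring.
  have c1 := LP (a *: u + v); rewrite E in c1.
  have c2 : a * (Lk k u - Lk N u) + (Lk k v - Lk N v) @[k --> \oo] --> a * L u + L v.
    exact: (cvgD (cvgM (cvg_cst a) (LP u)) (LP v)).
  exact: (complex_cvg_unique c1 c2).
pose Ll : {linear V -> R[i]} := HB.pack L (GRing.isLinear.Build _ _ _ _ L Llin).
have Lb h : modulus (L h) <= 8 / r * modulus h.
  apply: (modulus_cvg_le (LP h)); near=> k; rewrite -diffd.
  have Nk : (N <= k)%N by near: k; exact: nbhs_infty_ge.
  have [h1 _] := tay 1 k N (NP _ _ Nk (leqnn N)).
  by rewrite (le_trans (h1 h))// mulr1 mulrA mulrAC.
have dg : differentiable (fun w => f w - f_ N w) z.
  apply: (@modulus_differentiable _ _ _ _ Ll).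
    exact: (@linear_modulus_continuous _ _ Ll _ Lb).
  move=> e e0; exists (Num.min (r / 4) (e * r ^+ 2 / 32)).
    by rewrite lt_min !divr_gt0// mulr_gt0// exprn_gt0.
  move=> h; rewrite lt_min => /andP[hr he].
  have zh : modulus (z + h - z) <= r by rewrite addrAC subrr add0r; lra.
  have cv : (d k N (z + h) - d k N z - 'd (d k N) z h) @[k --> \oo] -->
      (f (z + h) - f_ N (z + h) - (f z - f_ N z) - Ll h).
    apply: cvgB; last by under eq_fun do rewrite diffd; exact: LP.
    apply: cvgB; (apply: cvgB; last exact: cvg_cst); exact: fl.
  apply: (modulus_cvg_le cv); near=> k.
  have Nk : (N <= k)%N by near: k; exact: nbhs_infty_ge.
  have [_ h2] := tay 1 k N (NP _ _ Nk (leqnn N)).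
  rewrite (le_trans (h2 _ (ltW hr)))// mulr1.
  rewrite (_ : 32 * _ = 32 * modulus h / r ^+ 2 * modulus h); last by field; rewrite gt_eqF.
  rewrite ler_wpM2r ?modulus_ge0// ler_pdivrMr ?exprn_gt0//.
  by move: he; set m := modulus h; set q := e * r ^+ 2; lra.
rewrite (_ : f = (fun w => (f w - f_ N w) + f_ N w)); last first.
  by apply/funext => w; rewrite subrK.
exact: (differentiableD dg (df N z zr)).
Unshelve. all: by end_near. Qed.

End uniform_limit.

(** * Real coordinates on C^n and compactness *)

Section complex_rows.
Context {R : realType} {n : nat}.
Local Notation Cn := 'rV[R[i]]_n.
Implicit Types (z w : Cn) (x y : 'rV[R]_(n + n)).

Lemma modulus_coord_le z j : modulus (z ord0 j) <= modulus z.
Proof.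
rewrite -lecR -!normr_modulus -[leRHS]/(mx_norm z) mx_normE.
by rewrite -[leLHS]nngE num_le; exact: (le_bigmax _ _ (ord0, j)).
Qed.

Lemma modulus_le_coord z (C : R) : 0 <= C ->
  (forall j, modulus (z ord0 j) <= C) -> modulus z <= C.
Proof.
move=> C0 zC; have [z0|z0] := eqVneq (mx_norm z) 0.
  by rewrite (mx_norm_eq0 z0) modulus0.
have [[i j] zE] := mx_norm_neq0 z0.
rewrite -lecR -normr_modulus -[leLHS]/(mx_norm z) zE/= normr_modulus lecR.
by rewrite (ord1 i).
Qed.

(** The same coordinates as [complex_point], but on real rows, where closed bounded sets are
    compact; maxima and cluster points are found there and carried over to C^n. *)
Definition complexify x : Cn := \row_j (x ord0 (lshift n j) +i* x ord0 (rshift n j))%C.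

Definition realify z : 'rV[R]_(n + n) :=
  \row_i match fintype.split i with
         | inl j => complex.Re (z ord0 j)
         | inr j => complex.Im (z ord0 j)
         end.

Lemma realifyK : cancel realify complexify.
Proof.
move=> z; apply/rowP => j; rewrite !mxE.
have -> : fintype.split (lshift n j) = inl j by exact: (unsplitK (inl j)).
have -> : fintype.split (rshift n j) = inr j by exact: (unsplitK (inr j)).
by case: (z ord0 j).
Qed.

Lemma complexifyB x y : complexify (x - y) = complexify x - complexify y.
Proof. by apply/rowP => j; rewrite !mxE. Qed.

Lemma realifyB z w : realify (z - w) = realify z - realify w.
Proof. by apply/rowP => j; rewrite !mxE; case: (fintype.split j) => k; rewrite !mxE raddfB. Qed.

Lemma row_norm_coord_le x i : `|x ord0 i| <= `|x|.
Proof.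
rewrite -[leRHS]/(mx_norm x) mx_normE.
by rewrite -[leLHS]nngE num_le; exact: (le_bigmax _ _ (ord0, i)).
Qed.

Lemma row_norm_le_coord x (C : R) : 0 <= C -> (forall j, `|x ord0 j| <= C) -> `|x| <= C.
Proof.
move=> C0 zC; have [z0|z0] := eqVneq (mx_norm x) 0.
  by rewrite (mx_norm_eq0 z0) normr0.
have [[i j] zE] := mx_norm_neq0 z0.
by rewrite -[leLHS]/(mx_norm x) zE/= (ord1 i).
Qed.

Lemma modulus_complexify_le x : modulus (complexify x) <= 2 * `|x|.
Proof.
apply: modulus_le_coord => [|j]; first by rewrite mulr_ge0.
rewrite mxE (le_trans (modulus_le_ReIm _))//= mulr_natl mulr2n.
by rewrite lerD// row_norm_coord_le.
Qed.

Lemma norm_realify_le z : `|realify z| <= modulus z.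
Proof.
apply: row_norm_le_coord => [|j]; first exact: modulus_ge0.
rewrite mxE; case: (fintype.split j) => k.
- by rewrite (le_trans (Re_le_modulus _))// modulus_coord_le.
- by rewrite (le_trans (Im_le_modulus _))// modulus_coord_le.
Qed.

Lemma complexify_continuous : continuous complexify.
Proof.
move=> x; apply: (@cvg_modulusP _ _ (nbhs x) (nbhs_filter x) _ _ _).2 => e e0.
have e2 : 0 < e / 2 by rewrite divr_gt0.
apply: (@filterS _ (nbhs x) (nbhs_filter x) _ _ _ (nbhsx_ballx x _ e2)) => y.
rewrite -ball_normE /= => xy; rewrite -complexifyB.
by rewrite (le_lt_trans (modulus_complexify_le _))// -ltr_pdivlMl// mulrC distrC.
Qed.

Lemma modulus_continuous {V : normedModType R[i]} : continuous (modulus : V -> R).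
Proof.
move=> z; apply: (@cvgrPdist_lt _ _ _ (nbhs z) (nbhs_filter z) _ _).2 => e e0.
apply: (nbhs_modulusP z _).2; exists e => // w wz.
rewrite (le_lt_trans _ wz)// ler_norml; apply/andP; split.
  by rewrite lerNl opprB lerB_modulus.
by rewrite modulusB lerB_modulus.
Qed.

Lemma compact_ball w (r : R) : compact [set x | modulus (complexify x - w) <= r].
Proof.
apply: bounded_closed_compact.
  exists (`|r| + `|realify w|); split; first exact: num_real.
  move=> M /ltW rM x /= xr; apply: le_trans rM.
  have xE : x = realify (complexify x - w) + realify w.
    rewrite realifyB subrK; apply/rowP => i; rewrite mxE; case: fintype.splitP => j ij.
    - by rewrite mxE/=; congr (x ord0 _); exact/val_inj.
    - by rewrite mxE/=; congr (x ord0 _); exact/val_inj.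
  rewrite xE (le_trans (ler_normD _ _))// lerD2r (le_trans (norm_realify_le _))//.
  by rewrite (le_trans xr)// ler_norm.
have -> : [set x | modulus (complexify x - w) <= r] =
    (fun x => modulus (complexify x - w)) @^-1` [set t | t <= r] by [].
apply: closed_comp => [x _|]; last exact: closed_le.
apply: (@continuous_comp _ _ _ (fun x => complexify x - w) modulus).
  by apply: (cvgB (complexify_continuous (x := x))); exact: cvg_cst.
exact: modulus_continuous.
Qed.

Lemma max_on_ball w (r : R) (F : Cn -> R) : 0 <= r ->
  (forall z, modulus (z - w) <= r -> {for z, continuous F}) ->
  exists2 z, modulus (z - w) <= r & forall z', modulus (z' - w) <= r -> F z' <= F z.
Proof.
move=> r0 cF.
have A0 : [set x | modulus (complexify x - w) <= r] !=set0.
  by exists (realify w) => /=; rewrite realifyK subrr modulus0.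
have cFw : {within [set x | modulus (complexify x - w) <= r], continuous (F \o complexify)}.
  apply: continuous_in_subspaceT => x; rewrite inE /= => xr.
  by apply: continuous_comp; [exact: complexify_continuous|exact: cF].
have [x xr xF] := EVT_max_rV A0 (@compact_ball w r) cFw.
rewrite inE/= in xr; exists (complexify x) => // z zr.
by have := xF (realify z); rewrite inE /= realifyK; exact.
Qed.

(** A cluster point is given rather than a convergent subsequence, because the indices are selected
    later, jointly with conditions coming from the distance. *)
Lemma bounded_cluster (u : nat -> Cn) (C : R) : (forall k, modulus (u k) <= C) ->
  exists w, forall (e : R) (N : nat), 0 < e -> exists2 k, (N <= k)%N & modulus (u k - w) < e.
Proof.
move=> uC.
have F1 : ProperFilter ((realify \o u) @ \oo) by exact: fmap_proper_filter.
have [|x [_ xcl]] := @compact_ball 0 C ((realify \o u) @ \oo) F1.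
  by exists 0%N => // k _; rewrite /= realifyK subr0.
exists (complexify x) => e N e0.
have e2 : 0 < e / 2 by rewrite divr_gt0.
have [||y [[k Nk <-] ky]] := xcl ((realify \o u) @` [set k | (N <= k)%N]) (ball x (e / 2)).
- by exists N => // k Nk; exists k.
- exact: nbhsx_ballx.
exists k => //; rewrite -{1}(realifyK (u k)) -complexifyB.
rewrite (le_lt_trans (modulus_complexify_le _))// -ltr_pdivlMl// mulrC distrC.
by move: ky; rewrite -ball_normE.
Qed.

End complex_rows.

Lemma bounded_set_modulus {R : realType} {V : normedModType R[i]} (A : set V) :
  bounded_set A -> exists C : R, forall z, A z -> modulus z <= C.
Proof.
move=> [M [/RRe_real ME AM]]; exists (complex.Re M + 1) => z Az.
have MC : M < (complex.Re M + 1)%:C%C by rewrite -[X in X < _]ME ltcR ltrDl.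
by have := AM _ MC z Az; rewrite /= normr_modulus lecR.
Qed.

(** * The Bergman space *)

Section boxes.
Context {R : realType}.
Notation Rm := (measurableTypeR R).

(** Cubes of half-side [s]: their volume is given by [lebesgue_tuple_box], so they take the place of
    balls wherever a volume is computed. *)
Definition box m (a : 'I_m -> R) (s : R) : set (m.-tuple Rm) :=
  [set x | forall i, `|tnth x i - a i| < s].

Lemma boxE m (a : 'I_m -> R) (s : R) :
  box a s = [set x | forall i, (`]a i - s, a i + s[%classic : set Rm) (tnth x i)].
Proof.
by apply/seteqP; split => x h i; have := h i; rewrite /= in_itv/= distrC ltr_distlC.
Qed.

Lemma measurable_box m (a : 'I_m -> R) (s : R) : measurable (box a s).
Proof.
rewrite boxE (_ : [set _ | _] =
  \bigcap_(i in [set: 'I_m]) ((@tnth m _ ^~ i) @^-1` `]a i - s, a i + s[%classic)).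
  apply: fin_bigcap_measurable => // i _.
  by rewrite -[X in measurable X]setTI; exact: measurable_tnth.
by apply/seteqP; split => x /= h i; [move=> _|]; exact: h.
Qed.

Lemma lebesgue_box m (a : 'I_m -> R) (s : R) : 0 < s ->
  lebesgue_tuple R m (box a s) = ((2 * s) ^+ m)%:E.
Proof.
move=> s0; rewrite boxE.
apply: (etrans (@lebesgue_tuple_box R m (fun i => `]a i - s, a i + s[%classic) _)).
  by move=> i; exact: measurable_itv.
rewrite (eq_bigr (fun=> (2 * s)%:E)) => [|i _].
  by rewrite prodEFin prodr_const card_ord.
apply: (etrans (lebesgue_measure_itv _)).
rewrite /= lte_fin ltrBlDr -addrA ltrDl addr_gt0//.
by rewrite -EFinB; congr EFin; ring.
Qed.

End boxes.

(** * Measurability of subsets of C^n and of functions on them *)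

Section complex_points.
Context {R : realType} {n : nat}.
Notation Rm := (measurableTypeR R).
Local Notation Cn := 'rV[R[i]]_n.
Local Notation cp := (@complex_point R n).
Implicit Types (z w : Cn) (x y : (n + n).-tuple Rm).

Lemma complex_pointE x : cp x = complexify (\row_i tnth x i).
Proof. by apply/rowP => j; rewrite !mxE. Qed.

Lemma box_complex_point z (s : R) x : 0 <= s ->
  box (fun i => realify z ord0 i) s x -> modulus (cp x - z) <= 2 * s.
Proof.
move=> s0 xz; rewrite complex_pointE -{1}(realifyK z) -complexifyB.
rewrite (le_trans (modulus_complexify_le _))// ler_wpM2l//.
by apply: row_norm_le_coord => // i; have := xz i; rewrite !mxE => /ltW.
Qed.

Lemma realify_complex_point x i : realify (cp x) ord0 i = tnth x i.
Proof.
rewrite mxE; case: fintype.splitP => j ij; rewrite mxE/=; congr tnth; exact/val_inj.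
Qed.

Lemma complex_point_box z x (s : R) : modulus (cp x - z) < s ->
  box (fun i => realify z ord0 i) s x.
Proof.
move=> xz i; rewrite -realify_complex_point; apply: le_lt_trans xz.
apply: le_trans (norm_realify_le _); rewrite realifyB.
by have := @row_norm_coord_le R n (realify (cp x) - realify z) i; rewrite !mxE.
Qed.

(** The preimage is the union of those cubes with rational centre and half-side 1/(k+1) that it
    contains, a countable family. *)
Lemma measurable_preimage_open (U : set Cn) : open U -> measurable (cp @^-1` U).
Proof.
move=> oU.
pose B (qk : (n + n).-tuple rat * nat) : set ((n + n).-tuple Rm) :=
  box (fun i => ratr (tnth qk.1 i)) (qk.2.+1%:R^-1).
have -> : cp @^-1` U = \bigcup_qk (if pselect (B qk `<=` cp @^-1` U) then B qk else set0).
  apply/seteqP; split => [x Ux|x [qk _]]; last by case: pselect => // h /h.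
  have /nbhs_modulusP[e e0 eU] : nbhs (cp x) U by exact: open_nbhs_nbhs.
  (* Two points of such a cube differ by less than 2/(k+1) in each real coordinate, hence by at most
     4/(k+1) in C^n. *)
  have e4 : 0 < e / 4 by rewrite divr_gt0.
  have [k _ /(_ k (leqnn k)) ke] := near_infty_natSinv_lt (PosNum e4).
  have k0 : 0 < (k.+1%:R^-1 : R) by rewrite invr_gt0.
  have near_rat i : exists q : rat, `|tnth x i - ratr q| < k.+1%:R^-1.
    have /rat_in_itvoo[q qi] : tnth x i - k.+1%:R^-1 < tnth x i + k.+1%:R^-1.
      by rewrite ltrBlDr -addrA ltrDl addr_gt0.
    by exists q; rewrite ltr_distlC; move: qi; rewrite in_itv.
  have [q qx] := choice near_rat.
  exists ([tuple q i | i < n + n], k) => //.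
  have Bx : B ([tuple q i | i < n + n], k) x by move=> i; rewrite /= tnth_mktuple.
  case: pselect => // nB; exfalso; apply: nB => y By; apply: eU.
  apply: (@le_lt_trans _ _ (2 * (2 * k.+1%:R^-1))); last first.
    by move: ke => /=; set t := _^-1; lra.
  apply: box_complex_point; first by rewrite mulr_ge0// ltW.
  move=> i; rewrite realify_complex_point.
  rewrite (le_lt_trans (ler_distD (ratr (q i)) _ _))//.
  have := By i; have := Bx i; rewrite /= !tnth_mktuple => h1 h2.
  by rewrite mulr_natl mulr2n ltrD// distrC.
apply: countable_bigcupT_measurable => [|qk]; first exact: countableP.
by case: pselect => [a|a]; [exact: measurable_box|exact: measurable0].
Qed.

Lemma measurable_complex_point (Omega : set Cn) (g : Cn -> R) : open Omega ->
  (forall z, Omega z -> {for z, continuous g}) ->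
  measurable_fun (cp @^-1` Omega) (fun x => g (cp x)).
Proof.
move=> oO cg; apply: (measurability _ (measurable_realfun.RGenOInfty.measurableE R)) => _ [_ [a ->] <-].
rewrite (_ : _ `&` _ = cp @^-1` (Omega `&` g @^-1` `]a, +oo[%classic))//.
apply: measurable_preimage_open; rewrite openE => z [Oz gz].
apply: filterI; first exact: open_nbhs_nbhs.
apply: cg => //; apply: open_nbhs_nbhs; split => //; exact: interval_open.
Qed.

Lemma lebesgue_bounded_lty (Omega : set Cn) : bounded_set Omega -> open Omega ->
  (lebesgue_tuple R (n + n) (cp @^-1` Omega) < +oo)%E.
Proof.
move=> /bounded_set_modulus[C' C'O] oO.
pose C := `|C'|.
have OC z : Omega z -> modulus (z - 0) < C + 1.
  by move=> /C'O; rewrite subr0 => /le_lt_trans; apply; rewrite (le_lt_trans (ler_norm _))// ltrDl.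
have C0 : 0 < C + 1 by rewrite /C ltr_wpDl.
apply: (@le_lt_trans _ _ (lebesgue_tuple R (n + n) (box (fun i => realify (0 : Cn) ord0 i) (C + 1)))).
  apply: le_measure; rewrite ?inE; [exact: measurable_preimage_open|exact: measurable_box|].
  by move=> x /OC; exact: complex_point_box.
by rewrite (lebesgue_box _ C0) ltry.
Qed.

End complex_points.

Section bergman_space.
Context {R : realType} {n : nat}.
Notation Rm := (measurableTypeR R).
Local Notation Cn := 'rV[R[i]]_n.
Local Notation cp := (@complex_point R n).
Local Notation mu := (lebesgue_tuple R (n + n)).
Variables (p : R) (Omega : set Cn).
Hypotheses (p1 : 1 <= p) (oO : open Omega).
Implicit Types (f g : Cn -> R[i]) (z w : Cn) (F G : (n + n).-tuple Rm -> R).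

Local Notation D := (cp @^-1` Omega).

Let p0 : 0 < p. Proof. exact: lt_le_trans p1. Qed.
Let pn0 : p != 0. Proof. by rewrite gt_eqF. Qed.

(* The p-th power of the norm, kept extended real to avoid [fine]. *)
Definition energy f : \bar R := (\int[mu]_(x in D) (modulus (f (cp x)) `^ p)%:E)%E.

Lemma measurable_domain : measurable D.
Proof. exact: measurable_preimage_open. Qed.

Lemma energy_ge0 f : (0 <= energy f)%E.
Proof. by apply: integral_ge0 => x _; rewrite lee_fin powR_ge0. Qed.

Lemma ext_Lp_normE f : ext_Lp_norm p Omega f = (energy f `^ p^-1)%E.
Proof.
rewrite /ext_Lp_norm unlock /energy; congr (_ `^ _)%E; rewrite [RHS]integral_mkcond.
apply: eq_integral => x _; rewrite /patch; case: ifPn => _.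
  rewrite -[LHS]/((`|(modulus (f (cp x)))%:E| `^ p)%E) abse_EFin poweR_EFin.
  by rewrite ger0_norm// modulus_ge0.
by rewrite /= normr0 powR0.
Qed.

Lemma ext_Lp_norm_lty f : (ext_Lp_norm p Omega f < +oo)%E <-> (energy f < +oo)%E.
Proof.
rewrite ext_Lp_normE; split; last exact: poweR_lty.
by apply: lty_poweRy; rewrite invr_neq0.
Qed.

Lemma holomorphic_continuous f z : holomorphic Omega f -> Omega z -> {for z, continuous f}.
Proof. by move=> hf /hf; exact: differentiable_continuous. Qed.

Lemma measurable_modulus f : holomorphic Omega f -> measurable_fun D (fun x => modulus (f (cp x))).
Proof.
move=> hf; apply: (@measurable_complex_point _ _ Omega (fun z => modulus (f z)) oO) => z Oz.
by apply: continuous_comp; [exact: holomorphic_continuous hf Oz|exact: modulus_continuous].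
Qed.

Lemma measurable_energy f : holomorphic Omega f ->
  measurable_fun D (EFin \o (fun x => modulus (f (cp x)) `^ p)).
Proof.
move=> hf; apply/measurable_EFinP.
exact: (measurableT_comp (measurable_realfun.measurable_powR p) (measurable_modulus hf)).
Qed.

(** Holomorphic functions are continuous, so the measurability clauses of [Lp_fun] follow, and
    finiteness of the energy is what remains to check. *)
Lemma bergmanP f : bergman p Omega f <-> holomorphic Omega f /\ (energy f < +oo)%E.
Proof.
split; first by move=> [[_ _ /ext_Lp_norm_lty fp] hf].
move=> [hf fp]; split => //; split; last exact/ext_Lp_norm_lty.
- apply: (@measurable_complex_point _ _ Omega (fun z => complex.Re (f z)) oO) => z Oz.
  by apply: continuous_comp; [exact: holomorphic_continuous hf Oz|exact: Re_continuous].
- apply: (@measurable_complex_point _ _ Omega (fun z => complex.Im (f z)) oO) => z Oz.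
  by apply: continuous_comp; [exact: holomorphic_continuous hf Oz|exact: Im_continuous].
Qed.

Lemma Lp_norm_ge0 f : 0 <= Lp_norm p Omega f.
Proof. by rewrite /Lp_norm fine_ge0// ext_Lp_normE poweR_ge0. Qed.

Lemma energyE f : bergman p Omega f -> energy f = (Lp_norm p Omega f `^ p)%:E.
Proof.
move=> [[_ _ fp] _]; rewrite -poweR_EFin /Lp_norm fineK.
  rewrite ext_Lp_normE -poweRrM mulVf// poweRe1//; exact: energy_ge0.
by rewrite ge0_fin_numE// ext_Lp_normE poweR_ge0.
Qed.

Lemma energy_le f g : holomorphic Omega f -> holomorphic Omega g ->
  (forall z, Omega z -> modulus (f z) <= modulus (g z)) -> (energy f <= energy g)%E.
Proof.
move=> hf hg fg; apply: ge0_le_integral.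
- exact: measurable_domain.
- by move=> x _; rewrite lee_fin powR_ge0.
- exact: measurable_energy.
- exact: measurable_energy.
- move=> x Dx; rewrite lee_fin; apply: ge0_ler_powR; rewrite ?nnegrE ?modulus_ge0//.
    exact: ltW.
  exact: fg.
Qed.

Lemma Lp_norm_le f (C : R) : 0 <= C -> (energy f <= (C `^ p)%:E)%E -> Lp_norm p Omega f <= C.
Proof.
move=> C0 fC; rewrite /Lp_norm ext_Lp_normE -lee_fin fineK.
  have -> : C%:E = ((C `^ p)%:E `^ p^-1)%E.
    by rewrite poweR_EFin -powRrM mulfV// powRr1.
  apply: gt0_ler_poweR => //; first by rewrite invr_ge0 ltW.
  - by rewrite in_itv/= energy_ge0 leey.
  - by rewrite in_itv/= lee_fin powR_ge0 leey.
rewrite ge0_fin_numE ?poweR_ge0// poweR_lty//; apply: le_lt_trans fC _; exact: ltry.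
Qed.

Lemma bergman_le f g : holomorphic Omega f -> bergman p Omega g ->
  (forall z, Omega z -> modulus (f z) <= modulus (g z)) ->
  bergman p Omega f /\ Lp_norm p Omega f <= Lp_norm p Omega g.
Proof.
move=> hf bg fg; have hg : holomorphic Omega g by case: bg.
have fge := energy_le hf hg fg; have gE := energyE bg.
split; first by apply/bergmanP; split => //; rewrite (le_lt_trans fge)// gE ltry.
by apply: Lp_norm_le; [exact: Lp_norm_ge0|rewrite -gE].
Qed.

Lemma holomorphicD f g : holomorphic Omega f -> holomorphic Omega g ->
  holomorphic Omega (fun z => f z + g z).
Proof. by move=> hf hg z Oz; exact: (differentiableD (hf z Oz) (hg z Oz)). Qed.

Lemma holomorphicM f g : holomorphic Omega f -> holomorphic Omega g ->
  holomorphic Omega (fun z => f z * g z).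
Proof. by move=> hf hg z Oz; exact: (differentiableM (hf z Oz) (hg z Oz)). Qed.

Lemma holomorphic_cst (c : R[i]) : holomorphic Omega (fun=> c).
Proof. by move=> z Oz; exact: differentiable_cst. Qed.

Lemma holomorphicX f k : holomorphic Omega f -> holomorphic Omega (fun z => f z ^+ k).
Proof.
move=> hf; elim: k => [|k IH]; first exact: holomorphic_cst.
rewrite (_ : (fun z => _) = (fun z => f z * f z ^+ k)); first exact: holomorphicM hf IH.
by apply/funext => z; rewrite exprS.
Qed.

Lemma bergmanD f g : bergman p Omega f -> bergman p Omega g ->
  bergman p Omega (fun z => f z + g z) /\
  Lp_norm p Omega (fun z => f z + g z) <= Lp_norm p Omega f + Lp_norm p Omega g.
Proof.
move=> bf bg; have [_ hf] := bf; have [_ hg] := bg.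
(* Minkowski's inequality is applied on the whole space to the moduli, extended by 0 outside the
   domain; |f + g| <= |f| + |g| does the rest. *)
pose F (h : Cn -> R[i]) : (n + n).-tuple Rm -> R := (fun x => modulus (h (cp x))) \_ D.
have mF h : holomorphic Omega h -> measurable_fun [set: (n + n).-tuple Rm] (F h).
  by move=> hh; apply/(measurable_restrictT _ measurable_domain); exact: measurable_modulus.
have normE h : ext_Lp_norm p Omega h = 'N[mu]_p%:E[EFin \o F h]%E.
  by rewrite /ext_Lp_norm -restrict_EFin.
have hfg := holomorphicD hf hg.
have : (energy (fun z => f z + g z)%R `^ p^-1 <= ext_Lp_norm p Omega f + ext_Lp_norm p Omega g)%E.
  rewrite !normE; apply: le_trans (minkowski_EFin mu (mF _ hf) (mF _ hg) p1).
  rewrite unlock; apply: gt0_ler_poweR; first by rewrite invr_ge0 ltW.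
  - by rewrite in_itv/= energy_ge0 leey.
  - by rewrite in_itv/= leey andbT; apply: integral_ge0.
  rewrite /energy [leLHS]integral_mkcond; apply: ge0_le_integral => //.
  - by move=> x _; rewrite /patch; case: ifP => // _; rewrite lee_fin powR_ge0.
  - exact: ((measurable_restrictT _ measurable_domain).1 (measurable_energy hfg)).
  - rewrite (_ : (fun x => _) = EFin \o (fun x => `|F f x + F g x| `^ p)); last first.
      by apply/funext => x; rewrite /comp -poweR_EFin.
    apply/measurable_EFinP.
    apply: (measurableT_comp (measurable_realfun.measurable_powR p)).
    by apply: (measurableT_comp (@normr_measurable R setT)); exact: measurable_funD (mF _ hf) (mF _ hg).
  - move=> x _; rewrite /= /F /patch; case: ifP => Dx; last first.
      by rewrite lee_fin powR_ge0.
    rewrite lee_fin; apply: ge0_ler_powR; rewrite ?nnegrE ?modulus_ge0//.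
      exact: ltW.
    by rewrite ger0_norm ?addr_ge0 ?modulus_ge0// le_modulusD.
have [[_ _ fp] _] := bf; have [[_ _ gp] _] := bg.
have Efin h : (ext_Lp_norm p Omega h < +oo)%E -> ext_Lp_norm p Omega h = (Lp_norm p Omega h)%:E.
  by move=> hp; rewrite /Lp_norm fineK// ge0_fin_numE// ext_Lp_normE poweR_ge0.
rewrite -ext_Lp_normE (Efin _ fp) (Efin _ gp) -EFinD => le_fg.
have fgp : (ext_Lp_norm p Omega (fun z => f z + g z)%R < +oo)%E.
  by rewrite (le_lt_trans le_fg)// ltry.
split; first by apply/bergmanP; split => //; exact/ext_Lp_norm_lty.
by rewrite -lee_fin -(Efin _ fgp).
Qed.

Lemma bergmanZ (c : R[i]) f : bergman p Omega f ->
  bergman p Omega (fun z => c * f z) /\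
  Lp_norm p Omega (fun z => c * f z) = modulus c * Lp_norm p Omega f.
Proof.
move=> bf; have [_ hf] := bf.
have hcf : holomorphic Omega (fun z => c * f z) by exact: holomorphicM (holomorphic_cst c) hf.
have E : energy (fun z => c * f z) = ((modulus c * Lp_norm p Omega f) `^ p)%:E.
  rewrite powRM ?modulus_ge0 ?Lp_norm_ge0// EFinM -energyE// /energy.
  rewrite -ge0_integralZl_EFin; [|exact: measurable_domain| |exact: measurable_energy|exact: powR_ge0].
    by apply: eq_integral => x _; rewrite modulusM powRM ?modulus_ge0// EFinM.
  by move=> x _; rewrite lee_fin powR_ge0.
have bcf : bergman p Omega (fun z => c * f z) by apply/bergmanP; rewrite E ltry.
split => //; move: E; rewrite energyE// => -[] E.
have := congr1 (fun t => t `^ p^-1) E.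
by rewrite -!powRrM mulfV// !powRr1 ?mulr_ge0 ?modulus_ge0 ?Lp_norm_ge0.
Qed.

Lemma bergmanB f g : bergman p Omega f -> bergman p Omega g ->
  bergman p Omega (fun z => f z - g z).
Proof.
move=> bf bg; have [bNg _] := bergmanZ (-1) bg; have [bfg _] := bergmanD bf bNg.
by rewrite (_ : (fun z => _ - _) = (fun z => f z + -1 * g z))//; apply/funext => z; rewrite mulN1r.
Qed.

Lemma bergman_cst (c : R[i]) : bounded_set Omega -> bergman p Omega (fun=> c).
Proof.
move=> bO; apply/bergmanP; split; first exact: holomorphic_cst.
rewrite /energy integral_cst; last exact: measurable_domain.
by rewrite lte_mul_pinfty ?lee_fin ?powR_ge0// lebesgue_bounded_lty.
Qed.

End bergman_space.

(** * Bounded point evaluations *)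

Section point_evaluation.
Context {R : realType} {n : nat}.
Notation Rm := (measurableTypeR R).
Local Notation Cn := 'rV[R[i]]_n.
Local Notation cp := (@complex_point R n).
Local Notation mu := (lebesgue_tuple R (n + n)).

Lemma ler_powR_inv (p a b : R) : 0 < p -> 0 <= a -> 0 <= b -> a `^ p <= b `^ p -> a <= b.
Proof.
move=> p0 a0 b0 ab; have pn0 : p != 0 by rewrite gt_eqF.
have pV0 : 0 <= p^-1 by rewrite invr_ge0 ltW.
have := ge0_ler_powR pV0 (powR_ge0 a p : _ \is Num.nneg) (powR_ge0 b p : _ \is Num.nneg) ab.
by rewrite -!powRrM mulfV// !powRr1.
Qed.

(* In place of the mean value property: at a maximum point [z0] of
   |f(z)| (rho - |z - w|)^N the function f is controlled on a ball around z0, so by the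
   Lipschitz estimate |f| >= |f(z0)|/2 on a small box, which bounds the integral below.
   The exponent N = 2n + 1 lets the weight absorb the volume of that box. *)
Lemma point_evaluation_bound (p : R) (Omega : set Cn) (rho : R) :
  1 <= p -> open Omega -> 0 < rho -> rho <= 1 ->
  exists2 C : R, 0 <= C & forall w, (forall z, modulus (z - w) <= rho -> Omega z) ->
    forall f, bergman p Omega f -> modulus (f w) <= C * Lp_norm p Omega f.
Proof.
move=> p1 oO r0 r1; have p0 : 0 < p by exact: lt_le_trans p1.
(* With this [K], the Lipschitz bound on a ball of radius d / 2 where |f| <= 2^N A gives, for
   displacements up to d / K, 16 (2^N A) (2 / K) = A / 2. *)
pose N := (n + n).+1; pose K : R := 64 * 2 ^+ N.
have K0 : 0 < K by rewrite mulr_gt0// exprn_gt0.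
pose K' := (K ^+ (n + n)) `^ p^-1.
have K'0 : 0 <= K' by exact: powR_ge0.
exists (2 * K' / rho ^+ N); first by rewrite mulr_ge0 ?invr_ge0 ?mulr_ge0 ?exprn_ge0// ltW.
move=> w wO f bf; have [_ hf] := bf.
have L0 := Lp_norm_ge0 Omega p1 f; set L := Lp_norm p Omega f in L0 *.
have rN : 0 < rho ^+ N by exact: exprn_gt0.
have [fw0|fw0] := eqVneq (f w) 0.
  by rewrite fw0 modulus0 !mulr_ge0// invr_ge0 ltW.
pose F z := modulus (f z) * (rho - modulus (z - w)) ^+ N.
have cF z : modulus (z - w) <= rho -> {for z, continuous F}.
  move=> zw; apply: continuousM.
    apply: continuous_comp; last exact: modulus_continuous.
    exact: (holomorphic_continuous hf (wO _ zw)).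
  apply: (@continuous_comp _ _ _ (fun z => rho - modulus (z - w)) (fun t => t ^+ N)); last exact: exprn_continuous.
  apply: continuousB; first exact: cst_continuous.
  apply: (@continuous_comp _ _ _ (fun z => z - w) modulus); last exact: modulus_continuous.
  by apply: continuousB; [exact: cvg_id|exact: cst_continuous].
have [z0 z0w z0F] := max_on_ball (ltW r0) cF.
have Fw : F w = modulus (f w) * rho ^+ N by rewrite /F subrr modulus0 subr0.
have Fz0 : 0 < F z0.
  rewrite (lt_le_trans _ (z0F w _))//; last by rewrite subrr modulus0 ltW.
  by rewrite Fw mulr_gt0// modulus_gt0.
pose d := rho - modulus (z0 - w).
have d0 : 0 < d.
  rewrite lt_neqAle subr_ge0 z0w andbT; apply: contraTneq Fz0 => d0.
  by rewrite /F -/d -d0 expr0n/= mulr0 ltxx.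
have d1 : d <= 1 by rewrite (le_trans _ r1)// lerBlDr lerDl modulus_ge0.
set A := modulus (f z0).
have A0 : 0 <= A by exact: modulus_ge0.
(* Within d / 2 of [z0] the weight is still at least (d / 2)^N, so maximality at [z0] costs only the
   factor 2^N. *)
have near z : modulus (z - z0) <= d / 2 -> modulus (z - w) <= rho /\ modulus (f z) <= 2 ^+ N * A.
  move=> zz0.
  have zw : modulus (z - w) <= rho - d / 2.
    by rewrite (le_trans (ler_dist_modulusD z0 _ _))// /d; move: zz0; rewrite /d; lra.
  split; first by rewrite (le_trans zw)// gerBl divr_ge0// ltW.
  have := z0F z (le_trans zw _); rewrite gerBl => /(_ (divr_ge0 (ltW d0) (ler0n _ 2))).
  rewrite /F -/A -/d => h.
  have h2 : modulus (f z) * (d / 2) ^+ N <= A * d ^+ N.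
    apply: le_trans h; rewrite ler_wpM2l ?modulus_ge0//.
    apply: lerXn2r; rewrite ?nnegrE.
    - by rewrite divr_ge0// ltW.
    - by rewrite subr_ge0 (le_trans zw)// gerBl divr_ge0// ltW.
    - by rewrite lerBrDl -lerBrDr.
  move: h2; rewrite expr_div_n mulrA ler_pdivrMr ?exprn_gt0// mulrAC.
  by rewrite ler_pM2r ?exprn_gt0// mulrC.
pose delta := d / K.
have del0 : 0 < delta by exact: divr_gt0.
have N1 : 1 <= 2 ^+ N :> R by apply: exprn_ege1; lra.
have del_le : delta <= d / 2 / 4.
  rewrite /delta ler_pdivrMr// -mulrA -[leLHS]mulr1 -!mulrA ler_pM2l//.
  by rewrite /K; lra.
have lip h : modulus h <= delta -> A / 2 <= modulus (f (z0 + h)).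
  move=> hd.
  have hz z : modulus (z - z0) <= d / 2 -> differentiable f z.
    by move=> /near[/wO/hf].
  have hM z : modulus (z - z0) <= d / 2 -> modulus (f z) <= 2 ^+ N * A by move=> /near[].
  have := holomorphic_lipschitz (divr_gt0 d0 (ltr0n _ 2)) hz hM (le_trans hd del_le).
  have : 16 * (2 ^+ N * A) * (modulus h / (d / 2)) <= A / 2.
    rewrite (_ : A / 2 = 16 * (2 ^+ N * A) * (delta / (d / 2))).
      by rewrite ler_wpM2l ?mulr_ge0 ?exprn_ge0// ler_wpM2r// invr_ge0 ltW// divr_gt0.
    by rewrite /delta /K; field; rewrite gt_eqF//= expf_neq0// pnatr_eq0.
  have := lerB_modulus (f z0) (f (z0 + h)); rewrite modulusB -/A.
  set u := modulus (f (z0 + h) - f z0); set v := modulus (f (z0 + h)); lra.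
(* The half-side is delta / 2 because passing from real coordinates to the modulus costs a factor 2;
   the volume is delta^(2n). *)
pose B := box (fun i => realify z0 ord0 i) (delta / 2).
have Bh x : B x -> modulus (cp x - z0) <= delta.
  by move=> /box_complex_point; rewrite mulrCA divff// mulr1; apply; rewrite divr_ge0// ltW.
have BO : B `<=` cp @^-1` Omega.
  move=> y By; apply: wO; have [] // := near (cp y) _.
  by rewrite (le_trans (Bh y By))// (le_trans del_le)//; move: d0; lra.
have mB : measurable B by exact: measurable_box.
have en : (((A / 2) `^ p * delta ^+ (n + n))%:E <= (L `^ p)%:E)%E.
  rewrite -(energyE p1 bf) /energy.
  apply: (@le_trans _ _ (\int[mu]_(x in B) ((A / 2) `^ p)%:E)%E).
    rewrite integral_cst// [X in (_ <= _ * X)%E](_ : _ = (delta ^+ (n + n))%:E) ?EFinM//.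
    apply: (etrans (lebesgue_box _ (divr_gt0 del0 (ltr0n R 2)))).
    by rewrite mulrCA divff// mulr1.
  apply: (@le_trans _ _ (\int[mu]_(x in B) (modulus (f (cp x)) `^ p)%:E)%E).
    apply: ge0_le_integral => //.
    - by move=> x _; rewrite lee_fin powR_ge0.
    - by apply: measurable_funS (measurable_energy p oO hf) => //; exact: measurable_domain.
    - move=> x Bx; rewrite lee_fin; apply: ge0_ler_powR; rewrite ?nnegrE ?modulus_ge0 ?divr_ge0 ?(ltW p0)//.
      by rewrite -(subrKC z0 (cp x)); apply: lip; exact: Bh.
  apply: ge0_subset_integral => //; first exact: measurable_domain.
    exact: measurable_energy.
  by move=> x _; rewrite lee_fin powR_ge0.
rewrite mulrAC ler_pdivlMr// -Fw (le_trans (z0F w _))//.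
  by rewrite subrr modulus0 ltW.
rewrite /F -/A -/d -mulrA -ler_pdivrMl//.
have dN0 : 0 <= d ^+ N by rewrite exprn_ge0 ?ltW.
apply: (@ler_powR_inv p) => //; rewrite ?mulr_ge0 ?invr_ge0//.
have A2 : 0 <= A / 2 by rewrite divr_ge0.
rewrite mulrA (mulrC 2^-1) (powRM _ A2 dN0) (powRM _ K'0 L0).
have -> : K' `^ p = K ^+ (n + n).
  by rewrite /K' -powRrM mulVf ?gt_eqF// powRr1// exprn_ge0// ltW.
(* As d <= 1 and p >= 1, (d^N)^p <= d^N <= d^(2n). *)
apply: (@le_trans _ _ ((A / 2) `^ p * d ^+ (n + n))).
  rewrite ler_wpM2l ?powR_ge0//.
  apply: (@le_trans _ _ ((d ^+ N) `^ 1)).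
    by apply: ger_powR => //; rewrite exprn_gt0// exprn_ile1// ltW.
  by rewrite powRr1// /N exprS ler_piMl// exprn_ge0// ltW.
move: en; rewrite lee_fin /delta expr_div_n mulrA ler_pdivrMr ?exprn_gt0//.
by move=> /le_trans; apply; rewrite mulrC.
Qed.

End point_evaluation.

Section powR_limit.
Context {R : realType}.

(** Away from 0 the power is differentiable. At 0 it may fail to be, and there u < e^(1/p) gives u^p
    < e directly. *)
Lemma cvg_powR (p : R) (u : nat -> R) (t : R) : 0 < p -> (forall k, 0 <= u k) ->
  u k @[k --> \oo] --> t -> u k `^ p @[k --> \oo] --> t `^ p.
Proof.
move=> p0 u0 ut; have t0 : 0 <= t.
  by apply: (ler_cvg_to (cvg_cst 0) ut); exact: nearW.
move: t0; rewrite le_eqVlt => /predU1P[t0|t0].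
  rewrite -t0 in ut *; rewrite powR0 ?gt_eqF//; apply/cvgrPdist_lt => e e0.
  have ep : 0 < e `^ p^-1 by exact: powR_gt0.
  near=> k; rewrite sub0r normrN ger0_norm ?powR_ge0//.
  have uk : u k < e `^ p^-1.
    rewrite (le_lt_trans (ler_norm _))// -normrN -sub0r.
    by near: k; exact: cvgr_dist_lt.
  rewrite -[ltRHS](@powRr1 _ e) ?ltW// -(mulVf (lt0r_neq0 p0)) powRrM.
  by apply: gt0_ltr_powR; rewrite ?nnegrE ?powR_ge0.
have ct : {for t, continuous (fun x : R => x `^ p)}.
  apply: differentiable_continuous; apply/derivable1_diffP.
  exact: (@ex_derive _ _ _ _ _ _ _ (is_derive1_powR p t0)).
exact: (cvg_comp _ _ ut ct).
Unshelve. all: by end_near. Qed.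

End powR_limit.

(** * Completeness of the Bergman space *)

Section bergman_completeness.
Context {R : realType} {n : nat}.
Notation Rm := (measurableTypeR R).
Local Notation Cn := 'rV[R[i]]_n.
Local Notation cp := (@complex_point R n).
Local Notation mu := (lebesgue_tuple R (n + n)).
Variables (p : R) (Omega : set Cn).
Hypotheses (p1 : 1 <= p) (oO : open Omega).
Implicit Types (f g : Cn -> R[i]) (z w : Cn).

Let p0 : 0 < p. Proof. exact: lt_le_trans p1. Qed.

(** One constant serves all points near z, which turns convergence in norm into locally uniform
    convergence. *)
Lemma local_evaluation_bound z : Omega z -> exists rho C : R,
  [/\ 0 < rho, 0 <= C & forall w, modulus (w - z) <= rho -> Omega w /\
    forall f, bergman p Omega f -> modulus (f w) <= C * Lp_norm p Omega f].
Proof.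
move=> Oz; have /nbhs_modulusP[e e0 eO] : nbhs z Omega by exact: open_nbhs_nbhs.
pose rho := Num.min 1 (e / 4).
have r0 : 0 < rho by rewrite lt_min ltr01 divr_gt0.
have r1 : rho <= 1 by rewrite ge_min lexx.
have re : rho <= e / 4 by rewrite ge_min lexx orbT.
have [C C0 CP] := point_evaluation_bound p1 oO r0 r1.
exists rho, C; split => // w wz; split.
  by apply: eO; rewrite (le_lt_trans wz)//; lra.
apply: CP => y yw; apply: eO; rewrite (le_lt_trans (ler_dist_modulusD w _ _))//.
by move: wz yw; set u := modulus _; set v := modulus _; lra.
Qed.

Lemma energy_fatou (g_ : nat -> Cn -> R[i]) g (C : \bar R) :
  (forall k, holomorphic Omega (g_ k)) ->
  (forall z, Omega z -> g_ k z @[k --> \oo] --> g z) ->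
  (forall k, (energy p Omega (g_ k) <= C)%E) -> (energy p Omega g <= C)%E.
Proof.
move=> hg gl gC.
pose G k (x : (n + n).-tuple Rm) : \bar R := (modulus (g_ k (cp x)) `^ p)%:E.
have mG k : measurable_fun (cp @^-1` Omega) (G k) by exact: measurable_energy.
have G0 k x : (cp @^-1` Omega) x -> (0 <= G k x)%E by rewrite lee_fin powR_ge0.
have := fatou mu (measurable_domain oO) mG G0.
have -> : (\int[mu]_(x in cp @^-1` Omega) limn_einf (G^~ x))%E = energy p Omega g.
  apply: eq_integral => x; rewrite inE => Ox.
  have gx : G k x @[k --> \oo] --> (modulus (g (cp x)) `^ p)%:E.
    apply: cvg_EFin; first exact: nearW.
    apply: cvg_powR => // [k|]; first exact: modulus_ge0.
    exact: (cvg_modulus (gl _ Ox)).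
  by have [] := cvg_limn_einf_sup gx.
move=> /le_trans; apply; rewrite limn_einf_lim.
apply: lime_le; first exact: is_cvg_einfs.
apply: nearW => k; apply: (le_trans _ (gC k)).
by apply: ereal_inf_lbound; exists k => //=.
Qed.

Lemma bergman_complete (f_ : nat -> Cn -> R[i]) :
  (forall k, bergman p Omega (f_ k)) ->
  (forall e : R, 0 < e -> exists N, forall k l, (N <= k)%N -> (N <= l)%N ->
    Lp_norm p Omega (fun z => f_ k z - f_ l z) <= e) ->
  exists f, [/\ bergman p Omega f,
    (forall z, Omega z -> f_ k z @[k --> \oo] --> f z) &
    forall e : R, 0 < e -> exists N, forall k, (N <= k)%N ->
      Lp_norm p Omega (fun z => f_ k z - f z) <= e].
Proof.
move=> bf cf.
have hf k : holomorphic Omega (f_ k) by case: (bf k).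
have unif (rho C : R) (z : Cn) : 0 <= C -> (forall w, modulus (w - z) <= rho -> Omega w /\ forall f, bergman p Omega f -> modulus (f w) <= C * Lp_norm p Omega f) ->
    forall e : R, 0 < e -> exists N, forall k l, (N <= k)%N -> (N <= l)%N ->
    forall w, modulus (w - z) <= rho -> modulus (f_ k w - f_ l w) <= e.
  move=> C0 zC e e0; have C1 : 0 < C + 1 by rewrite ltr_wpDl.
  have [N NP] := cf _ (divr_gt0 e0 C1).
  exists N => k l kN lN w wz; have [_ wC] := zC w wz.
  rewrite (le_trans (wC _ (bergmanB p1 oO (bf k) (bf l))))//.
  rewrite (le_trans (ler_wpM2l C0 (NP k l kN lN)))// mulrA ler_pdivrMr//.
  by rewrite mulrC ler_wpM2l ?lerDl// ltW.
have lim_exists z : exists l : R[i], Omega z -> f_ k z @[k --> \oo] --> l.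
  have [Oz|nOz] := pselect (Omega z); last by exists 0.
  have [rho [C [r0 C0 zC]]] := local_evaluation_bound Oz.
  have [|l lP] := @complex_complete R (fun k => f_ k z); last by exists l.
  move=> e e0; have [N NP] := unif _ _ _ C0 zC e e0.
  by exists N => k l kN lN; apply: NP => //; rewrite subrr modulus0 ltW.
have [f fl] := choice lim_exists.
have hfl : holomorphic Omega f.
  move=> z Oz; have [rho [C [r0 C0 zC]]] := local_evaluation_bound Oz.
  apply: (differentiable_uniform_limit r0 _ (unif _ _ _ C0 zC)).
  - by move=> k w wz; apply: hf; have [] := zC w wz.
  - by move=> w wz; apply: fl; have [] := zC w wz.
have hB g h : holomorphic Omega g -> holomorphic Omega h ->
    holomorphic Omega (fun z => g z - h z).
  by move=> hg hh z Oz; exact: (differentiableB (hg z Oz) (hh z Oz)).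
(* Fatou's lemma in l with k fixed. The limit is not yet known to lie in A^p, so the estimate is on
   the energy, which carries its own finiteness. *)
have key e : 0 < e -> exists N, forall k, (N <= k)%N ->
    (energy p Omega (fun z => f_ k z - f z)%R <= (e `^ p)%:E)%E.
  move=> e0; have [N NP] := cf _ e0; exists N => k kN.
  apply: (@energy_fatou (fun l z => f_ k z - f_ (l + N)%N z)).
  - by move=> l; exact: hB.
  - move=> z Oz; apply: cvgB; first exact: cvg_cst.
    by have := fl z Oz; rewrite -(cvg_shiftn N).
  - move=> l; rewrite (energyE p1 (bergmanB p1 oO (bf k) (bf _))) lee_fin.
    apply: ge0_ler_powR; rewrite ?nnegrE ?(Lp_norm_ge0 _ p1) ?(ltW e0) ?(ltW p0)//.
    by apply: NP => //; rewrite leq_addl.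
have bfl : bergman p Omega f.
  have [N /(_ N (leqnn N)) NP] := key 1 ltr01.
  have bd : bergman p Omega (fun z => f_ N z - f z).
    apply/(bergmanP p1 oO); split; first exact: hB.
    by rewrite (le_lt_trans NP)// ltry.
  have := bergmanB p1 oO (bf N) bd.
  rewrite (_ : (fun z => f_ N z - (f_ N z - f z)) = f)//.
  by apply/funext => z; rewrite opprB addrC subrK.
exists f; split => // e e0; have [N NP] := key e e0; exists N => k kN.
by apply: (Lp_norm_le p1 (ltW e0)); exact: NP.
Qed.

End bergman_completeness.

(** * Clarkson's inequality and the minimizers *)

Section clarkson.
Context {R : realType}.

(** Write t^q = t t^(q-1) and bound both x^(q-1) and y^(q-1) by (x + y)^(q-1). *)
Lemma powR_superadditive (q x y : R) : 1 <= q -> 0 <= x -> 0 <= y ->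
  x `^ q + y `^ q <= (x + y) `^ q.
Proof.
move=> q1 x0 y0; have q0 : 0 <= q - 1 by rewrite subr_ge0.
have qE (t : R) : 0 <= t -> t `^ q = t * t `^ (q - 1).
  move=> t0; rewrite -{2}(powRr1 t0) -powRD; first by rewrite subrKC.
  by rewrite subrKC; apply/implyP => /eqP q00; move: q1; rewrite q00 ler10.
rewrite !qE ?addr_ge0// mulrDl lerD// ler_wpM2l//.
- by apply: ge0_ler_powR => //=; rewrite ?nnegrE ?addr_ge0 ?lerDl ?lerDr.
- by apply: ge0_ler_powR => //=; rewrite ?nnegrE ?addr_ge0 ?lerDl ?lerDr.
Qed.

Lemma powR_midpoint (q x y : R) : 1 <= q -> 0 <= x -> 0 <= y ->
  ((x + y) / 2) `^ q <= (x `^ q + y `^ q) / 2.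
Proof.
move=> q1 x0 y0; rewrite mulrC mulrDr [leRHS]mulrC mulrDr.
rewrite {2 4}(_ : 2^-1 = 1 - 2^-1); last by rewrite {2}(splitr 1) div1r addrK.
by apply: (convex_powR q1 (Itv01 _ _)) => //=;
  rewrite ?inE/= ?in_itv/= ?andbT// ?invr_ge0// invf_le1 ?ler1n.
Qed.

Lemma modulus_half : modulus (2^-1 : R[i]) = 2^-1.
Proof. by rewrite modulusV -(rmorph_nat (real_complex R)) modulusR normr_nat. Qed.

(** Put q = p / 2 >= 1 and work with squares of moduli: superadditivity of t^q, then the
    parallelogram identity, then convexity of t^q at the midpoint. *)
Lemma clarkson_modulus (p : R) (a b : R[i]) : 2 <= p ->
  modulus (2^-1 * (a + b)) `^ p + modulus (2^-1 * (a - b)) `^ p <=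
  2^-1 * (modulus a `^ p + modulus b `^ p).
Proof.
move=> p2; rewrite [leRHS]mulrC; have q1 : 1 <= p / 2 by rewrite ler_pdivlMr// mul1r.
have pE (z : R[i]) : modulus z `^ p = (modulus z ^+ 2) `^ (p / 2).
  by rewrite -powR_mulrn ?modulus_ge0// -powRrM mulrCA divff// mulr1.
rewrite !pE; apply: le_trans (powR_midpoint q1 (sqr_ge0 _) (sqr_ge0 _)).
apply: le_trans (powR_superadditive q1 (sqr_ge0 _) (sqr_ge0 _)) _.
rewrite le_eqVlt; apply/orP; left; apply/eqP; congr (_ `^ _).
rewrite !modulusM modulus_half !exprMn !sqr_modulus !raddfB !raddfD/=.
by field.
Qed.

End clarkson.

(** * Existence and uniqueness of the minimizers *)

Section minimizer.
Context {R : realType} {n : nat}.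
Notation Rm := (measurableTypeR R).
Local Notation Cn := 'rV[R[i]]_n.
Local Notation cp := (@complex_point R n).
Local Notation mu := (lebesgue_tuple R (n + n)).
Variables (p : R) (Omega : set Cn).
Hypotheses (p2 : 2 <= p) (oO : open Omega) (bO : bounded_set Omega).
Implicit Types (f g : Cn -> R[i]) (z w : Cn).
Local Notation norm := (Lp_norm p Omega).
Local Notation m := (bergman_min p Omega).

Let p1 : 1 <= p. Proof. by rewrite (le_trans _ p2)// ler1n. Qed.
Let p0 : 0 < p. Proof. exact: lt_le_trans p1. Qed.

Lemma norm_powR_le (s d f g : Cn -> R[i]) :
  bergman p Omega s -> bergman p Omega d -> bergman p Omega f -> bergman p Omega g ->
  (forall z, modulus (s z) `^ p + modulus (d z) `^ p <=
             2^-1 * (modulus (f z) `^ p + modulus (g z) `^ p)) ->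
  norm s `^ p + norm d `^ p <= 2^-1 * (norm f `^ p + norm g `^ p).
Proof.
move=> bs bd bf bg sdfg.
have [hs hd] : holomorphic Omega s /\ holomorphic Omega d by case: bs bd => [_ ?] [].
have [hf hg] : holomorphic Omega f /\ holomorphic Omega g by case: bf bg => [_ ?] [].
have mD := measurable_domain oO.
pose E (h : Cn -> R[i]) (x : (n + n).-tuple Rm) : \bar R := (modulus (h (cp x)) `^ p)%:E.
have E0 h x : (0 <= E h x)%E by rewrite lee_fin powR_ge0.
have mE h : holomorphic Omega h -> measurable_fun (cp @^-1` Omega) (E h).
  by move=> hh; exact: (measurable_energy p oO hh).
have mEE u v : holomorphic Omega u -> holomorphic Omega v ->
    measurable_fun (cp @^-1` Omega) (fun x => E u x + E v x)%E.
  by move=> hu hv; exact: (emeasurable_funD (mE _ hu) (mE _ hv)).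
have ED u v : holomorphic Omega u -> holomorphic Omega v ->
    (energy p Omega u + energy p Omega v = \int[mu]_(x in cp @^-1` Omega) (E u x + E v x))%E.
  by move=> hu hv; rewrite (ge0_integralD mu mD _ (mE _ hu) _ (mE _ hv)).
rewrite -lee_fin EFinD EFinM EFinD.
rewrite -(energyE p1 bs) -(energyE p1 bd) -(energyE p1 bf) -(energyE p1 bg).
rewrite (ED _ _ hs hd) (ED _ _ hf hg) -ge0_integralZl_EFin//; first last.
- exact: mEE.
- by move=> x _; rewrite adde_ge0.
apply: ge0_le_integral => //.
- by move=> x _; rewrite adde_ge0.
- exact: mEE.
- by apply: measurable_funeM; exact: mEE.
- by move=> x _; exact: (etrans (lee_fin _ _) (sdfg (cp x))).
Qed.

Lemma clarkson_norm f g : bergman p Omega f -> bergman p Omega g ->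
  norm (fun z => 2^-1 * (f z + g z)) `^ p + norm (fun z => 2^-1 * (f z - g z)) `^ p <=
  2^-1 * (norm f `^ p + norm g `^ p).
Proof.
move=> bf bg; have [bs _] := bergmanD p1 oO bf bg; have bd := bergmanB p1 oO bf bg.
have [bs2 _] := bergmanZ p1 oO 2^-1 bs; have [bd2 _] := bergmanZ p1 oO 2^-1 bd.
by apply: (norm_powR_le bs2 bd2 bf bg) => z; exact: clarkson_modulus.
Qed.

Lemma norm_distC f g : bergman p Omega f -> bergman p Omega g ->
  norm (fun z => f z - g z) = norm (fun z => g z - f z).
Proof.
move=> bf bg; have [_ e] := bergmanZ p1 oO (-1) (bergmanB p1 oO bf bg).
rewrite modulusN modulus1 mul1r in e; rewrite -e; congr Lp_norm.
by apply/funext => z; rewrite mulN1r opprB.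
Qed.

Lemma norm_triangle f g : bergman p Omega f -> bergman p Omega g ->
  norm f <= norm g + norm (fun z => f z - g z).
Proof.
move=> bf bg; have [_] := bergmanD p1 oO bg (bergmanB p1 oO bf bg).
by rewrite (_ : (fun z => g z + _) = f)//; apply/funext => z; rewrite subrKC.
Qed.

(** The constant 1 is a competitor because Omega has finite volume; without competitors the infimum
    would be a mere default value. *)
Lemma has_inf_norms z : has_inf [set norm f | f in [set f | bergman p Omega f /\ f z = 1]].
Proof.
split; last by exists 0 => _ [f _ <-]; exact: (Lp_norm_ge0 _ p1).
exists (norm (fun=> 1)); exists (fun=> 1) => //; split => //; exact: bergman_cst.
Qed.

Lemma bergman_min_le z f : bergman p Omega f -> f z = 1 -> m z <= norm f.
Proof.
move=> bf fz; apply: ge_inf; last by exists f.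
by exists 0 => _ [g _ <-]; exact: (Lp_norm_ge0 _ p1).
Qed.

Lemma bergman_min_ge0 z : 0 <= m z.
Proof.
apply: lb_le_inf; first by have [] := has_inf_norms z.
by move=> _ [f _ <-]; exact: (Lp_norm_ge0 _ p1).
Qed.

(** The evaluation bound forces 1 <= C ||f|| for every competitor; C + 1 replaces C to have a
    positive denominator. *)
Lemma bergman_min_gt0 z : Omega z -> 0 < m z.
Proof.
move=> Oz; have [rho [C [r0 C0 /(_ z)]]] := local_evaluation_bound p1 oO Oz.
rewrite subrr modulus0 => /(_ (ltW r0))[_ zC].
have C1 : 0 < C + 1 by rewrite ltr_wpDl.
apply: (@lt_le_trans _ _ (C + 1)^-1); first by rewrite invr_gt0.
apply: lb_le_inf; first by have [] := has_inf_norms z.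
move=> _ [f [bf fz] <-]; rewrite -div1r ler_pdivrMr//.
have := zC f bf; rewrite fz modulus1 => /le_trans; apply.
by rewrite mulrC ler_wpM2l ?lerDl//; exact: (Lp_norm_ge0 _ p1).
Qed.

Lemma modulus_bergman_min_le z f : Omega z -> bergman p Omega f ->
  modulus (f z) * m z <= norm f.
Proof.
move=> Oz bf; have [fz|fz] := eqVneq (f z) 0.
  by rewrite fz modulus0 mul0r; exact: (Lp_norm_ge0 _ p1).
have [bg ng] := bergmanZ p1 oO (f z)^-1 bf.
have := bergman_min_le bg (mulVf fz); rewrite ng modulusV mulrC ler_pdivlMr ?modulus_gt0//.
by rewrite mulrC.
Qed.

(** The midpoint of two competitors is a competitor, so its norm is at least [m z], and Clarkson's
    inequality leaves at most (e / 2)^p for half their difference. A positive e makes minimizing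
    sequences Cauchy; e = 0 gives uniqueness. *)
Lemma dist_le_clarkson z f g (e : R) : bergman p Omega f -> bergman p Omega g ->
  f z = 1 -> g z = 1 -> 0 <= e ->
  norm f `^ p <= m z `^ p + (e / 2) `^ p -> norm g `^ p <= m z `^ p + (e / 2) `^ p ->
  norm (fun x => f x - g x) <= e.
Proof.
move=> bf bg fz gz e0 fe ge; have := clarkson_norm bf bg.
have [bs _] := bergmanD p1 oO bf bg; have bd := bergmanB p1 oO bf bg.
have [bs2 _] := bergmanZ p1 oO 2^-1 bs; have [bd2 d2] := bergmanZ p1 oO 2^-1 bd.
have hz : 2^-1 * (f z + g z) = 1 by rewrite fz gz; field.
have mle : m z `^ p <= norm (fun z => 2^-1 * (f z + g z)) `^ p.
  apply: ge0_ler_powR; rewrite ?nnegrE ?bergman_min_ge0 ?(ltW p0) ?(Lp_norm_ge0 _ p1)//.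
  exact: bergman_min_le bs2 hz.
have arith (a b c d t r : R) : t <= a -> a + b <= 2^-1 * (c + d) ->
    c <= t + r -> d <= t + r -> b <= r by lra.
move=> cl; have := arith _ _ _ _ _ _ mle cl fe ge.
move=> /(ler_powR_inv p0 (Lp_norm_ge0 _ p1 _) (divr_ge0 e0 (ler0n _ 2))).
by rewrite d2 modulus_half mulrC ler_pM2r.
Qed.

Lemma bergman_minimizer_exists z : Omega z ->
  exists f, [/\ bergman p Omega f, f z = 1 & norm f = m z].
Proof.
move=> Oz.
have approx k : exists f : Cn -> R[i],
    [/\ bergman p Omega f, f z = 1 & norm f < m z + k.+1%:R^-1].
  have k0 : 0 < (k.+1%:R^-1 : R) by rewrite invr_gt0.
  have [_ [f [bf fz] <-] fk] := inf_adherent k0 (has_inf_norms z).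
  by exists f.
have [f_ fP] := choice approx.
have bf k : bergman p Omega (f_ k) by case: (fP k).
have fz k : f_ k z = 1 by case: (fP k).
have fm k : m z <= norm (f_ k) by exact: bergman_min_le.
have nm : norm (f_ k) @[k --> \oo] --> m z.
  apply/cvgrPdist_lt => e e0; near=> k.
  have [_ _ fk] := fP k; rewrite distrC ger0_norm ?subr_ge0// ltrBlDl.
  by rewrite (lt_trans fk)// ltrD2l; near: k; exact: (near_infty_natSinv_lt (PosNum e0)).
have npm := cvg_powR p0 (fun k => Lp_norm_ge0 Omega p1 (f_ k)) nm.
have cauchy_f e : 0 < e -> exists N, forall k l, (N <= k)%N -> (N <= l)%N ->
    norm (fun x => f_ k x - f_ l x) <= e.
  move=> e0; have ep : 0 < (e / 2) `^ p by rewrite powR_gt0// divr_gt0.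
  have /cvgrPdist_lt/(_ _ ep)[N _ NP] := npm.
  have le k : (N <= k)%N -> norm (f_ k) `^ p <= m z `^ p + (e / 2) `^ p.
    move=> kN; have := NP k kN; rewrite /= distrC -lerBlDl => h.
    by rewrite (le_trans (ler_norm _))// ltW.
  by exists N => k l kN lN; apply: (@dist_le_clarkson z); rewrite ?le// ltW.
have [f [bfl fl ff]] := bergman_complete p1 oO bf cauchy_f.
have flz : f z = 1.
  apply: (complex_cvg_unique (fl z Oz)).
  by under eq_fun do rewrite fz; exact: cvg_cst.
exists f; split => //; apply/eqP; rewrite eq_le bergman_min_le// andbT.
apply/ler_addgt0Pr => e e0; have e2 : 0 < e / 2 by rewrite divr_gt0.
have [N NP] := ff _ e2.
have /cvgrPdist_lt/(_ _ e2)[N' _ N'P] := nm.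
pose k := (N + N')%N.
rewrite (le_trans (norm_triangle bfl (bf k)))// norm_distC//.
have := NP k (leq_addr _ _); have := N'P k (leq_addl _ _); rewrite /= distrC.
move=> /(le_lt_trans (ler_norm _)); lra.
Unshelve. all: by end_near. Qed.

Lemma bergman_minimizerP z : Omega z ->
  [/\ bergman p Omega (bergman_minimizer p Omega z), bergman_minimizer p Omega z z = 1 &
      norm (bergman_minimizer p Omega z) = m z].
Proof. by move=> Oz; exact: (xgetPex _ (bergman_minimizer_exists Oz)). Qed.

Lemma bergman_minimizer_unique z f : Omega z -> bergman p Omega f -> f z = 1 ->
  norm f <= m z -> forall w, Omega w -> f w = bergman_minimizer p Omega z w.
Proof.
move=> Oz bf fz fm w Ow; have [bg gz gm] := bergman_minimizerP Oz.
set g := bergman_minimizer p Omega z in bg gz gm *.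
have [rho [C [r0 C0 /(_ w)]]] := local_evaluation_bound p1 oO Ow.
rewrite subrr modulus0 => /(_ (ltW r0))[_ wC].
have d0 : norm (fun x => f x - g x) <= 0.
  apply: (@dist_le_clarkson z) => //; rewrite mul0r powR0 ?gt_eqF// addr0 ?gm//.
  by apply: ge0_ler_powR; rewrite ?nnegrE ?bergman_min_ge0 ?(ltW p0) ?(Lp_norm_ge0 _ p1).
apply/eqP; rewrite -subr_eq0; apply/eqP/modulus0_eq0/eqP; rewrite eq_le modulus_ge0 andbT.
rewrite (le_trans (wC _ (bergmanB p1 oO bf bg)))//.
by rewrite mulr_ge0_le0.
Qed.

End minimizer.

(** * The Skwarczynski distance *)

Section unimodular.
Context {R : realType}.

Lemma modulus_expi (t : R) : modulus (expi t) = 1.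
Proof.
by apply/eqP; rewrite -sqrp_eq1 ?modulus_ge0// sqr_modulus/= cos2Dsin2.
Qed.

(** The arccosine of the real part reaches the closed upper half circle; below the real axis the
    angle is reflected to 2 pi - acos x. *)
Lemma unimodular_expi (a : R[i]) : modulus a = 1 -> exists2 t : R, 0 <= t <= 2 * pi & expi t = a.
Proof.
case: a => x y a1.
have xy : x ^+ 2 + y ^+ 2 = 1 by have := sqr_modulus (x +i* y)%C; rewrite a1 expr1n.
have x1 : -1 <= x <= 1 by rewrite -ler_norml -a1; exact: (Re_le_modulus (x +i* y)%C).
have y2 : 1 - x ^+ 2 = y ^+ 2 by rewrite -xy addrAC subrr add0r.
have [t0 tpi] := (acos_ge0 x1, acos_lepi x1).
have [y0|y0] := leP 0 y.
  exists (acos x); first by rewrite t0 (le_trans tpi)// mulr_natl mulr2n lerDl pi_ge0.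
  by rewrite /expi (acosK x1) (sin_acos x1) y2 sqrtr_sqr ger0_norm.
exists (2 * pi - acos x).
  by rewrite gerBl t0 andbT subr_ge0 (le_trans tpi)// mulr_natl mulr2n lerDl pi_ge0.
have E : 2 * pi - acos x = - acos x + pi *+ 2 by rewrite mulr_natl addrC.
rewrite /expi E cosD2pi sinD2pi cosN sinN (acosK x1) (sin_acos x1) y2 sqrtr_sqr.
by rewrite ltr0_norm ?opprK.
Qed.

End unimodular.

Section skwarczynski.
Context {R : realType} {n : nat}.
Notation Rm := (measurableTypeR R).
Local Notation Cn := 'rV[R[i]]_n.
Local Notation cp := (@complex_point R n).
Local Notation mu := (lebesgue_tuple R (n + n)).
Variables (p : R) (Omega : set Cn).
Hypotheses (p2 : 2 <= p) (oO : open Omega) (bO : bounded_set Omega).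
Implicit Types (f g : Cn -> R[i]) (z w : Cn).
Local Notation norm := (Lp_norm p Omega).
Local Notation m := (bergman_min p Omega).
Local Notation rho := (skwarczynski_dist p Omega).

Let p1 : 1 <= p. Proof. by rewrite (le_trans _ p2)// ler1n. Qed.
Let p0 : 0 < p. Proof. exact: lt_le_trans p1. Qed.

(** Written as in [skwarczynski_dist], so that the functions compared there unfold to rotations of
    [G z] minus [G w]. *)
Definition normalized_minimizer z : Cn -> R[i] :=
  fun x => bergman_minimizer p Omega z x / (m z)%:C%C.

Local Notation G := normalized_minimizer.

Lemma eq_norm f g : bergman p Omega f -> bergman p Omega g ->
  (forall z, Omega z -> f z = g z) -> norm f = norm g.
Proof.
move=> bf bg fg; apply/eqP; rewrite eq_le.
have [_ ->] : bergman p Omega f /\ norm f <= norm g.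
  by apply: (bergman_le p1 oO bf.2 bg) => z Oz; rewrite fg.
have [_ ->] // : bergman p Omega g /\ norm g <= norm f.
by apply: (bergman_le p1 oO bg.2 bf) => z Oz; rewrite fg.
Qed.

Lemma normalized_minimizerP z : Omega z ->
  [/\ bergman p Omega (G z), norm (G z) = 1 & modulus (G z z) * m z = 1].
Proof.
move=> Oz; have [bg gz gm] := bergman_minimizerP p2 oO bO Oz.
have m0 := bergman_min_gt0 p2 oO bO Oz.
have [bG nG] := bergmanZ p1 oO ((m z)%:C%C)^-1 bg.
have GE : G z = (fun x => ((m z)%:C%C)^-1 * bergman_minimizer p Omega z x).
  by apply/funext => x; rewrite mulrC.
rewrite GE; split => //.
  by rewrite nG gm modulusV modulusR gtr0_norm// mulVf// gt_eqF.
by rewrite modulusM gz modulus1 mulr1 modulusV modulusR gtr0_norm// mulVf// gt_eqF.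
Qed.

Lemma skwarczynski_dist_le z w (a : R[i]) : modulus a = 1 ->
  rho z w <= norm (fun x => a * G z x - G w x).
Proof.
move=> /unimodular_expi[t t02 <-]; apply: ge_inf; last by exists t.
by exists 0 => _ [s _ <-]; exact: (Lp_norm_ge0 _ p1).
Qed.

Let dists_neq0 z w :
  [set norm (fun x => expi t * G z x - G w x) | t in [set t : R | 0 <= t <= 2 * pi]] !=set0.
Proof.
by exists (norm (fun x => expi 0 * G z x - G w x)), 0; rewrite //= lexx mulr_ge0// pi_ge0.
Qed.

Lemma skwarczynski_dist_ge0 z w : 0 <= rho z w.
Proof.
by apply: lb_le_inf (dists_neq0 z w) _ => _ [s _ <-]; exact: (Lp_norm_ge0 _ p1).
Qed.

(** A strict upper bound on the infimum passes to some rotation. With [skwarczynski_dist_le] this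
    translates between the distance and norms in both directions. *)
Lemma skwarczynski_dist_lt z w (e : R) : rho z w < e ->
  exists2 a : R[i], modulus a = 1 & norm (fun x => a * G z x - G w x) < e.
Proof.
move=> H; have [_ [t _ <-] te] := inf_lt (dists_neq0 z w) H.
by exists (expi t); [exact: modulus_expi|].
Qed.

Lemma norm_cvg0_peak f (h : Cn -> R[i]) : bergman p Omega f -> holomorphic Omega h ->
  (forall z, Omega z -> modulus (h z) < 1) ->
  norm (fun z => h z ^+ k * f z) `^ p @[k --> \oo] --> 0.
Proof.
move=> bf hh h1; have [_ hf] := bf.
have bk k : bergman p Omega (fun z => h z ^+ k * f z).
  have hk := holomorphicM (holomorphicX k hh) hf.
  have [|bfk _] := bergman_le p1 oO hk bf; last exact: bfk.
    move=> z Oz; rewrite modulusM modulusX ler_piMl ?modulus_ge0//.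
    by rewrite exprn_ile1 ?modulus_ge0// ltW// h1.
have mD := measurable_domain oO.
pose F k (x : (n + n).-tuple Rm) : \bar R := (modulus (h (cp x) ^+ k * f (cp x)) `^ p)%:E.
pose g (x : (n + n).-tuple Rm) : \bar R := (modulus (f (cp x)) `^ p)%:E.
have mF k : measurable_fun (cp @^-1` Omega) (F k).
  by have [_ hk] := bk k; exact: (measurable_energy p oO hk).
have mg : measurable_fun (cp @^-1` Omega) g by exact: (measurable_energy p oO hf).
have ig : mu.-integrable (cp @^-1` Omega) g.
  apply/integrableP; split => //.
  rewrite (eq_integral g) => [|x _]; last by rewrite /g abse_EFin ger0_norm// powR_ge0.
  by rewrite -/(energy p Omega f) (energyE p1 bf) ltry.
have F0 : {ae mu, forall x, (cp @^-1` Omega) x -> F ^~ x @ \oo --> (cst 0%E : _ -> \bar R) x}.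
  apply/nearW => x Ox; rewrite /F /cst; apply: cvg_EFin; first exact: nearW.
  have c0 : modulus (h (cp x) ^+ k * f (cp x)) @[k --> \oo] --> (0 : R).
    have -> : (fun k => modulus (h (cp x) ^+ k * f (cp x))) =
        (fun k => modulus (h (cp x)) ^+ k * modulus (f (cp x))).
      by apply/funext => k; rewrite modulusM modulusX.
    rewrite -(mul0r (modulus (f (cp x)))); apply: cvgMl.
    by apply: cvg_expr; rewrite ger0_norm ?modulus_ge0// h1.
  have := cvg_powR p0 (fun k => modulus_ge0 _) c0.
  by rewrite powR0// gt_eqF.
have Fg : {ae mu, forall x k, (cp @^-1` Omega) x -> (`|F k x| <= g x)%E}.
  apply/nearW => x k Ox; rewrite /F /g abse_EFin ger0_norm ?powR_ge0// lee_fin.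
  apply: ge0_ler_powR; rewrite ?nnegrE ?modulus_ge0 ?(ltW p0)//.
  by rewrite modulusM modulusX ler_piMl ?modulus_ge0// exprn_ile1 ?modulus_ge0// ltW// h1.
have [_ _] := dominated_convergence mD mF (measurable_cst _) F0 ig Fg.
rewrite integral0 => /fine_cvg cF.
have -> : (fun k => norm (fun z => h z ^+ k * f z) `^ p) =
    (fun k => fine (\int[mu]_(x in cp @^-1` Omega) F k x)).
  by apply/funext => k; exact: (esym (congr1 fine (energyE p1 (bk k)))).
exact: cF.
Qed.

End skwarczynski.

(** * From Cauchy sequences for the distance to limits in the domain *)

Section completeness.
Context {R : realType} {n : nat}.
Local Notation Cn := 'rV[R[i]]_n.
Variables (p : R) (Omega : set Cn).
Hypotheses (p2 : 2 <= p) (oO : open Omega) (bO : bounded_set Omega).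
Implicit Types (f g : Cn -> R[i]) (z w : Cn).
Local Notation norm := (Lp_norm p Omega).
Local Notation m := (bergman_min p Omega).
Local Notation rho := (skwarczynski_dist p Omega).
Local Notation G := (normalized_minimizer p Omega).

Let p1 : 1 <= p. Proof. by rewrite (le_trans _ p2)// ler1n. Qed.

Lemma expr_half_small (e : R) : 0 < e -> exists N, forall k, (N <= k)%N -> (2^-1 : R) ^+ k < e.
Proof.
move=> e0; have h : `|2^-1 : R| < 1 by rewrite gtr0_norm ?invr_gt0// invf_lt1// ltr1n.
have [N _ NP] := cvgr_lt _ (cvg_expr h) _ e0.
by exists N => k Nk; exact: (NP k).
Qed.

Lemma norm_dist_triangle f g h : bergman p Omega f -> bergman p Omega g -> bergman p Omega h ->
  norm (fun z => f z - h z) <= norm (fun z => f z - g z) + norm (fun z => g z - h z).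
Proof.
move=> bf bg bh.
have := norm_triangle p2 oO (bergmanB p1 oO bf bh) (bergmanB p1 oO bf bg).
have -> // : (fun z => f z - h z - (f z - g z)) = (fun z => g z - h z).
by apply/funext => z; ring.
Qed.

Lemma rotated_minimizer z (a : R[i]) : Omega z -> modulus a = 1 ->
  [/\ bergman p Omega (fun x => a * G z x), norm (fun x => a * G z x) = 1 &
      modulus (a * G z z) * m z = 1].
Proof.
move=> Oz a1; have [bG nG Gm] := normalized_minimizerP p2 oO bO Oz.
have [bH nH] := bergmanZ p1 oO a bG.
split; first exact: bH.
  by rewrite nH a1 mul1r.
by rewrite modulusM a1 mul1r.
Qed.

Lemma rotated_limit (u : nat -> Cn) w : (forall k, Omega (u k)) ->
  skwarczynski_cauchy p Omega u ->
  (forall (e : R) N, 0 < e -> exists2 k, (N <= k)%N & modulus (u k - w) < e) ->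
  exists (phi : nat -> nat) (a : nat -> R[i]) f,
    [/\ bergman p Omega f, forall k, (k <= phi k)%N, forall k, modulus (a k) = 1,
        forall e : R, 0 < e -> exists N, forall k, (N <= k)%N -> modulus (u (phi k) - w) < e &
        forall e : R, 0 < e -> exists N, forall k, (N <= k)%N ->
          norm (fun z => a k * G (u (phi k)) z - f z) <= e].
Proof.
move=> uO cu uw; pose b k : R := 2^-1 ^+ k.
have b0 k : 0 < b k by rewrite exprn_gt0// invr_gt0.
have bS k : b k.+1 = b k / 2 by rewrite /b exprS mulrC.
have [M MP] := choice (fun k => cu _ (b0 k)).
(* The condition on [M k.-1] makes both [phi k] and [phi k.+1] at least [M k], as [M] need not be
   monotone. For the same reason [phi] need not increase; k <= phi k is what is kept. *)
have Hphi k : exists i, [/\ (k <= i)%N, (M k <= i)%N, (M k.-1 <= i)%N & modulus (u i - w) < b k].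
  have [i + wi] := uw (b k) (maxn k (maxn (M k) (M k.-1))) (b0 k).
  by rewrite !geq_max => /andP[ki /andP[Mi Mi']]; exists i.
have [phi phiP] := choice Hphi.
have Hs k : exists s : R[i], modulus s = 1 /\
    norm (fun x => s * G (u (phi k)) x - G (u (phi k.+1)) x) < b k.
  have [_ Mk _ _] := phiP k; have [_ _ Mk' _] := phiP k.+1.
  by have [s s1 sb] := skwarczynski_dist_lt (MP k _ _ Mk Mk'); exists s.
have [s sP] := choice Hs.
(* Since [a k.+1 * s k = a k], the difference [H k - H k.+1] is [a k.+1] times the pair aligned by
   [s k], and keeps its norm. *)
pose a := fix a k : R[i] := if k is i.+1 then a i * (s i)^-1 else 1.
have a1 k : modulus (a k) = 1.
  elim: k => [|k IH]; first exact: modulus1.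
  by rewrite /= modulusM IH modulusV (sP k).1 invr1 mulr1.
pose H k x := a k * G (u (phi k)) x.
have bH k : bergman p Omega (H k) by have [] := rotated_minimizer (uO (phi k)) (a1 k).
have HS k : norm (fun x => H k x - H k.+1 x) < b k.
  have [s1 sb] := sP k.
  have s0 : s k != 0 by apply: contra_eq_neq s1 => ->; rewrite modulus0 eq_sym oner_eq0.
  have [bs _ _] := rotated_minimizer (uO (phi k)) s1.
  have [bG _ _] := normalized_minimizerP p2 oO bO (uO (phi k.+1)).
  have [_] := bergmanZ p1 oO (a k.+1) (bergmanB p1 oO bs bG).
  rewrite a1 mul1r => nE; rewrite -nE in sb.
  have -> // : (fun x => H k x - H k.+1 x) =
    (fun x => a k.+1 * (s k * G (u (phi k)) x - G (u (phi k.+1)) x)).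
  apply/funext => x; rewrite /H mulrBr; congr (_ - _).
  by rewrite (mulrA _ (s k)) [a k.+1 * s k]divfK.
(* The right-hand side is the closed form of the geometric sum b_N + ... + b_(N+i-1). *)
have Hd N i : norm (fun x => H N x - H (N + i)%N x) <= 2 * b N - 2 * b (N + i)%N.
  elim: i => [|i IH].
    rewrite addn0 subrr; have [_] := bergmanZ p1 oO 0 (bH N).
    rewrite modulus0 mul0r.
    have -> : (fun x => H N x - H N x) = (fun x => 0 * H N x) by apply/funext => x; rewrite subrr mul0r.
    by move=> ->.
  rewrite addnS; apply: le_trans (norm_dist_triangle (bH N) (bH (N + i)%N) (bH _)) _.
  apply: le_trans (lerD IH (ltW (HS _))) _; rewrite bS.
  by rewrite le_eqVlt; apply/orP; left; apply/eqP; field.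
have Hd' N k : (N <= k)%N -> norm (fun x => H N x - H k x) <= 2 * b N.
  by move=> Nk; have := Hd N (k - N)%N; rewrite subnKC// => /le_trans; apply; rewrite gerBl mulr_ge0// ltW.
(* Consecutive terms are less than 2^-k apart, so the rotated minimizers are Cauchy. *)
have [|f [bf _ fP]] := bergman_complete p1 oO bH.
  move=> e e0; have [|N NP] := expr_half_small (e := e / 4); first by rewrite divr_gt0.
  exists N => k l Nk Nl.
  apply: le_trans (norm_dist_triangle (bH k) (bH N) (bH l)) _.
  rewrite (norm_distC p2 oO (bH k) (bH N)).
  apply: le_trans (lerD (Hd' _ _ Nk) (Hd' _ _ Nl)) _.
  have := NP N (leqnn _); rewrite -/(b N) ltr_pdivlMr// => /ltW.
  by rewrite -mulrDl mulrC -natrD.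
exists phi, a, f; split => //.
- by move=> k; have [] := phiP k.
- move=> e e0; have [N NP] := expr_half_small e0; exists N => k Nk.
  by have [_ _ _ /lt_trans] := phiP k; apply; exact: NP.
Qed.

Lemma rotated_minimizer_value z (a : R[i]) f : Omega z -> modulus a = 1 -> bergman p Omega f ->
  1 - norm (fun x => a * G z x - f x) <= modulus (f z) * m z.
Proof.
move=> Oz a1 bf; have [bH _ Hm] := rotated_minimizer Oz a1.
have le_d := modulus_bergman_min_le p2 oO Oz (bergmanB p1 oO bH bf).
rewrite lerBlDr -Hm; apply: le_trans (lerD (lexx _) le_d).
rewrite -mulrDl ler_wpM2r ?(bergman_min_ge0 p2 oO bO)//.
by rewrite -lerBlDl lerB_modulus.
Qed.

Section limit.
Variables (v : nat -> Cn) (w : Cn) (a : nat -> R[i]) (f : Cn -> R[i]).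
Hypotheses (vO : forall k, Omega (v k)) (a1 : forall k, modulus (a k) = 1).
Hypotheses (bf : bergman p Omega f) (vw : v k @[k --> \oo] --> w).
Hypothesis af : norm (fun x => a k * G (v k) x - f x) @[k --> \oo] --> 0.

Lemma norm_limit_le1 : norm f <= 1.
Proof.
rewrite -[leRHS]addr0; apply: ler_cvg_to (cvg_cst (norm f)) (cvgD (cvg_cst _) af) _.
apply: nearW => k; have [bH nH _] := rotated_minimizer (vO k) (a1 k).
by have := norm_triangle p2 oO bf bH; rewrite nH (norm_distC p2 oO bf bH).
Qed.

Lemma limit_interior : Omega w -> exists2 c : R[i], modulus c = 1 &
  forall x, Omega x -> c * f x = G w x.
Proof.
move=> Ow; have [bG nG Gm] := normalized_minimizerP p2 oO bO Ow.
have m0 := bergman_min_gt0 p2 oO bO Ow.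
have cont g : bergman p Omega g -> modulus (g (v k)) @[k --> \oo] --> modulus (g w).
  by move=> bg; apply: cvg_modulus; exact: (cvg_comp _ _ vw (holomorphic_continuous bg.2 Ow)).
(* The upper bound |G_w(v_k)| m(v_k) <= 1 replaces continuity of m at w. *)
have Gf : modulus (G w w) <= modulus (f w).
  rewrite -[leLHS]mul1r -[X in X * _]subr0.
  apply: ler_cvg_to (cvgM (cvgB (cvg_cst _) af) (cont _ bG)) (cont _ bf) _.
  apply: nearW => k.
  have h1 := rotated_minimizer_value (vO k) (a1 k) bf.
  have h2 := modulus_bergman_min_le p2 oO (vO k) bG.
  apply: le_trans (ler_wpM2r (modulus_ge0 _) h1) _.
  by rewrite -mulrA ler_piMr ?modulus_ge0// mulrC -nG.
have fm : modulus (f w) * m w = 1.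
  apply/eqP; rewrite eq_le (le_trans (modulus_bergman_min_le p2 oO Ow bf) norm_limit_le1)/=.
  by rewrite -Gm ler_wpM2r// ltW.
have f0 : f w != 0.
  by apply: contra_eq_neq fm => ->; rewrite modulus0 mul0r eq_sym oner_eq0.
have fw0 : 0 < modulus (f w) by rewrite modulus_gt0.
have fV : (modulus (f w))^-1 = m w.
  by rewrite -[RHS](mulKf (lt0r_neq0 fw0)) fm mulr1.
have [bg ng] := bergmanZ p1 oO (f w)^-1 bf.
have gE := bergman_minimizer_unique p2 oO bO Ow bg (mulVf f0).
(* f / f(w) is the minimizer at w, and dividing by [m w] normalizes it; |f(w)|^-1 = m w makes the
   constant unimodular. *)
exists ((f w)^-1 / (m w)%:C%C).
  by rewrite modulusM !modulusV modulusR gtr0_norm// fV divff// gt_eqF.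
move=> x Ox; rewrite /normalized_minimizer -gE//; first by rewrite mulrAC.
by rewrite ng modulusV fV ler_piMr ?norm_limit_le1// ltW.
Qed.

(** For fixed j, (1 - d_k) |h(v_k)|^j <= |(h^j f)(v_k)| m(v_k) <= ||h^j f||, where d_k is the norm
    tending to 0. If |h(v_k)| tended to 1, letting k grow would give ||h^j f|| >= 1 for all j,
    against [norm_cvg0_peak]. *)
Lemma limit_peak h : holomorphic Omega h -> (forall z, Omega z -> modulus (h z) < 1) ->
  ~ (modulus (h (v k)) @[k --> \oo] --> (1 : R)).
Proof.
move=> hh h1 hv.
have one_le j : 1 <= norm (fun z => h z ^+ j * f z).
  have lim : (1 - norm (fun x => a k * G (v k) x - f x)) * modulus (h (v k)) ^+ j
      @[k --> \oo] --> (1 - 0 : R) * 1 ^+ j.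
    apply: cvgM; first exact: (cvgB (cvg_cst _) af).
    exact: (cvg_comp _ _ hv (@exprn_continuous _ j 1)).
  rewrite -[leLHS](expr1n _ j) -[leLHS]mul1r -[X in X * _]subr0.
  apply: ler_cvg_to lim (cvg_cst _) _.
  apply: nearW => k.
  have [bg _] : bergman p Omega (fun z => h z ^+ j * f z) /\
      norm (fun z => h z ^+ j * f z) <= norm f.
    apply: (bergman_le p1 oO (holomorphicM (holomorphicX j hh) bf.2) bf) => z Oz.
    rewrite modulusM modulusX ler_piMl ?modulus_ge0//.
    by rewrite exprn_ile1 ?modulus_ge0// ltW// h1.
  have E1 := rotated_minimizer_value (vO k) (a1 k) bf.
  apply: le_trans (modulus_bergman_min_le p2 oO (vO k) bg).
  rewrite modulusM modulusX mulrC -mulrA.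
  by apply: ler_wpM2l E1; rewrite exprn_ge0// modulus_ge0.
have c0 := norm_cvg0_peak p2 oO bf hh h1.
have : 1 <= (0 : R).
  apply: ler_cvg_to (cvg_cst (1 : R)) c0 _; apply: nearW => j.
  apply: (@le_trans _ _ (1 `^ p)); first by rewrite powR1.
  rewrite ge0_ler_powR ?nnegrE ?one_le ?ler01 ?(Lp_norm_ge0 _ p1)//.
  exact: le_trans ler01 p1.
by rewrite ler10.
Qed.

End limit.

(** The whole sequence converges, not only the subsequence: for large j a rotation s aligns u_j with
    one fixed u_(phi k), a_k brings the latter close to f, and c carries f to G_w. The composite
    rotation c a_k s bounds the distance. *)
Lemma skwarczynski_cvg (u : nat -> Cn) w (phi : nat -> nat) a f (c : R[i]) :
  (forall k, Omega (u k)) -> Omega w -> skwarczynski_cauchy p Omega u ->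
  (forall k, (k <= phi k)%N) -> (forall k, modulus (a k) = 1) -> bergman p Omega f ->
  norm (fun x => a k * G (u (phi k)) x - f x) @[k --> \oo] --> 0 ->
  modulus c = 1 -> (forall x, Omega x -> c * f x = G w x) ->
  rho (u k) w @[k --> \oo] --> 0.
Proof.
move=> uO Ow cu phik a1 bf af c1 cf; apply/cvgrPdist_lt => e e0.
have e2 : 0 < e / 2 by rewrite divr_gt0.
have [N NP] := cu _ e2.
have [K _ KP] := cvgr_lt _ af _ e2.
pose k := maxn N K.
have dk : norm (fun x => a k * G (u (phi k)) x - f x) < e / 2 by apply: KP; exact: leq_maxr.
exists N => // j Nj; rewrite sub0r normrN ger0_norm; last exact: skwarczynski_dist_ge0.
have [s s1 sd] := skwarczynski_dist_lt (NP j (phi k) Nj (leq_trans (leq_maxl _ _) (phik k))).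
have ca1 : modulus (c * a k) = 1 by rewrite modulusM c1 a1 mulr1.
have cas1 : modulus (c * a k * s) = 1 by rewrite modulusM ca1 s1 mulr1.
apply: le_lt_trans (skwarczynski_dist_le Omega p2 _ _ cas1) _.
have [bj _ _] := rotated_minimizer (uO j) cas1.
have [bk _ _] := rotated_minimizer (uO (phi k)) ca1.
have [bw _ _] := normalized_minimizerP p2 oO bO Ow.
have nT := norm_dist_triangle bj bk bw.
apply: (le_lt_trans nT).
rewrite [ltRHS]splitr; apply: ltrD.
  have [bs _ _] := rotated_minimizer (uO j) s1.
  have [bG _ _] := normalized_minimizerP p2 oO bO (uO (phi k)).
  have [_] := bergmanZ p1 oO (c * a k) (bergmanB p1 oO bs bG).
  rewrite ca1 mul1r => nE; rewrite -nE in sd.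
  have -> // : (fun x => c * a k * s * G (u j) x - c * a k * G (u (phi k)) x) =
    (fun x => c * a k * (s * G (u j) x - G (u (phi k)) x)).
  by apply/funext => x; rewrite mulrBr (mulrA _ s).
have [ba _ _] := rotated_minimizer (uO (phi k)) (a1 k).
have bd := bergmanB p1 oO ba bf.
have [bcd] := bergmanZ p1 oO c bd.
rewrite c1 mul1r => nE; rewrite -nE in dk.
(* [c * f] agrees with [G w] on Omega only, which is all the norm sees. *)
rewrite (eq_norm p2 oO (bergmanB p1 oO bk bw) bcd)// => x Ox.
by rewrite mulrBr cf// (mulrA c).
Qed.

End completeness.

Unset Implicit Arguments.

Theorem theorem4p8 (R : realType) (n : nat) (p : R) (Omega : set 'rV[R[i]]_n)
    (hp : 2 < p) (hOmega : bounded_domain Omega)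
    (hpeak : forall w : 'rV[R[i]]_n, boundary Omega w ->
       exists h : 'rV[R[i]]_n -> R[i],
         [/\ holomorphic Omega h,
             forall zeta, Omega zeta -> `|h zeta| < 1 &
             `|h zeta| @[zeta --> within Omega (nbhs w)] --> (1 : R[i])]) :
  skwarczynski_complete p Omega.
Proof.
have [_ oO _ bO] := hOmega; have p2 := ltW hp.
move=> u uO cu.
have [C OC] : exists C : R, forall z, Omega z -> modulus z <= C.
  exact: bounded_set_modulus.
have [w uw] := bounded_cluster (fun k => OC _ (uO k)).
have [phi [a [f [bf phik a1 vw af]]]] := rotated_limit p2 oO bO uO cu uw.
have {}vw : u (phi k) @[k --> \oo] --> w.
  by apply/cvg_modulusP => e e0; have [N NP] := vw _ e0; exists N => // k Nk; exact: NP.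
have {}af : Lp_norm p Omega (fun z => a k * normalized_minimizer p Omega (u (phi k)) z - f z)
    @[k --> \oo] --> (0 : R).
  apply/cvgrPdist_le => e e0; have [N NP] := af _ e0; exists N => // k Nk.
  by rewrite sub0r normrN ger0_norm ?NP// Lp_norm_ge0// (le_trans _ p2)// ler1n.
have vO k : Omega (u (phi k)) := uO _.
have [Ow|Ow] := pselect (Omega w).
  have [c c1 cf] := limit_interior p2 oO bO vO a1 bf vw af Ow.
  by exists w => //; exact: (skwarczynski_cvg p2 oO bO uO Ow cu phik a1 bf af c1 cf).
(* w is in the closure as a cluster point of the sequence, and outside the interior because it is
   outside Omega. *)
have [|h [hh h1 hw]] := hpeak w.
  split.
    move=> A /nbhs_modulusP[e e0 eA]; have [k _ ke] := uw e 0%N e0.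
    by exists (u k); split => //; exact: eA.
  by move=> /interior_subset.
exfalso; apply: (limit_peak p2 oO bO vO a1 bf af hh).
  by move=> z /h1; rewrite normr_modulus (ltcR (modulus (h z)) 1).
have {}hw : modulus (h (u (phi k))) @[k --> \oo] --> (1 : R).
  apply/cvgrPdist_lt => e e0.
  have /nbhs_modulusP[d d0 dP] := (@cvg_modulusP _ _ _ (@within_filter _ Omega _ (nbhs_filter w)) _ _ _).1 hw e e0.
  have [N _ NP] := (cvg_modulusP _ _).1 vw d d0.
  exists N => // k Nk; have := dP _ (NP k Nk) (vO k).
  rewrite normr_modulus -(rmorphB (real_complex R)) modulusR distrC.
  by [].
exact: hw.
Qed.
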